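(* Fix $\boldsymbol\omega=(P,Q,W)\in\Omega$ and $K\subset\{1,\dots,2d\}$. Let $\mathbf A\in\mathcal O_K^{\mathbb C}$, let $\lambda_*$ be a simple eigenvalue of $(\boldsymbol\omega,\mathbf A)$, let $y$ be an eigenfunction for $\lambda_*$ normalized by $\int_a^b y^*Wy\,dt=1$, and let $\Lambda$ be a continuous simple eigenvalue branch defined on a neighborhood of $\mathbf A$ in $\mathcal O_K^{\mathbb C}$ through $\lambda_*$. Then $\Lambda$, regarded as a function of the Hermitian matrix $S(\mathbf B)$, is (Fréchet) differentiable at $\mathbf A$, and for every $2d\times2d$ Hermitian matrix $H$, $$d\Lambda\big|_{\mathbf A}(H)=u^*Hu,$$ where $u=(u_1,\dots,u_{2d})^T$ with $u_i=\rho_i$ for $i\in\{1,\dots,2d\}\setminus K$ and $u_i=\eta_i$ for $i\in K$, and $(\rho_1,\dots,\rho_{2d},\eta_1,\dots,\eta_{2d}):=(-y(a)^T,y(b)^T,(Py')(a)^T,(Py')(b)^T)$.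
   Context: Let $d\ge2$, $[a,b]$ compact. $\Omega$ is the set of triples $(P,Q,W)$ of $d\times d$ real symmetric matrix-valued functions in $L^\infty([a,b],\mathbb R^{d\times d})$ with $P(t)\ge\mu_1I_d$, $W(t)\ge\mu_2I_d$ a.e. for some $\mu_1,\mu_2>0$. $\mathcal B^{\mathbb C}$ is the quotient of the set of complex $2d\times4d$ matrices $(A\,|\,B)$ with $\operatorname{rank}(A\,|\,B)=2d$, $AB^*=BA^*$ by the left action of $GL(2d,\mathbb C)$, with quotient topology. The problem $(\boldsymbol\omega,[A\,|\,B])$ is $-(Py')'+Qy=\lambda Wy$ on $[a,b]$ with $(A\,|\,B)(-y(a)^T,y(b)^T,(Py')(a)^T,(Py')(b)^T)^T=0$; its eigenvalues are real and isolated, and an eigenvalue is simple if its multiplicity (equivalently, the dimension of its eigenspace) is $1$. For $K\subset\{1,\dots,2d\}$, $\mathcal O_K^{\mathbb C}$ is the set of $[A\,|\,B]$ having a representative with columns $a_i=-e_i$, $b_i=s_i$ ($i\in K$), $a_i=s_i$, $b_i=e_i$ ($i\notin K$), for a Hermitian $2d\times 2d$ matrix $S=(s_1,\dots,s_{2d})$ (uniquely determined, denoted $S(\mathbf A)$); $\mathbf B\mapsto S(\mathbf B)$ identifies $\mathcal O_K^{\mathbb C}$ with the real vector space of Hermitian $2d\times2d$ matrices. A continuous simple eigenvalue branch through $\lambda_*$ on a neighborhood $U$ of $\mathbf A$ is a continuous function $\Lambda:U\to\mathbb R$ with $\Lambda(\mathbf A)=\lambda_*$ such that, for some $r_1<\lambda_*<r_2$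 with $\lambda_*$ the only eigenvalue of $(\boldsymbol\omega,\mathbf A)$ in $[r_1,r_2]$, for each $\mathbf B\in U$ the number $\Lambda(\mathbf B)$ is the unique eigenvalue of $(\boldsymbol\omega,\mathbf B)$ in $(r_1,r_2)$ and is simple. *)

(* Defs.v *)
From HB Require Import structures.
From mathcomp Require Import all_boot all_order all_algebra.
From mathcomp Require Import all_classical all_reals all_analysis.
From mathcomp Require Import complex.

Set Implicit Arguments.
Unset Strict Implicit.
Unset Printing Implicit Defensive.

Import Order.TTheory GRing.Theory Num.Theory.
Import numFieldNormedType.Exports.

Local Open Scope classical_set_scope.
Local Open Scope ring_scope.
Local Open Scope complex_scope.

Definition cmx (R : realType) m n (A : 'M[R]_(m, n)) : 'M[R[i]]_(m, n) :=
  map_mx (fun x => x%:C) A.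

Definition adjmx (R : realType) m n (A : 'M[R[i]]_(m, n)) : 'M[R[i]]_(n, m) :=
  (map_mx (@conjc R) A)^T.

Definition is_herm (R : realType) n (S : 'M[R[i]]_n) : Prop :=
  adjmx S = S.

Definition Iab (R : realType) (a b : R) : set R := `[a, b]%classic.

Definition cint (R : realType) (a t : R) (f : R -> R[i]) : R[i] :=
  Complex (\int[@lebesgue_measure R]_(s in `[a, t]%classic) complex.Re (f s))
          (\int[@lebesgue_measure R]_(s in `[a, t]%classic) complex.Im (f s)).

Definition cint_vec (R : realType) d (a t : R) (f : R -> 'cV[R[i]]_d) : 'cV[R[i]]_d :=
  \col_i cint a t (fun s => f s i ord0).

Definition cintegrable (R : realType) d (a b : R) (f : R -> 'cV[R[i]]_d) : Prop :=
  forall i : 'I_d,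
    (@lebesgue_measure R).-integrable (Iab a b) (EFin \o (fun s => complex.Re (f s i ord0))) /\
    (@lebesgue_measure R).-integrable (Iab a b) (EFin \o (fun s => complex.Im (f s i ord0))).

Definition Linf_mx (R : realType) d (a b : R) (F : R -> 'M[R]_d) : Prop :=
  (forall i j : 'I_d, measurable_fun (Iab a b) (fun t => F t i j)) /\
  exists M : R, {ae @lebesgue_measure R, forall t,
     Iab a b t -> forall i j : 'I_d, `|F t i j| <= M}.

Definition symmetric_ae (R : realType) d (a b : R) (F : R -> 'M[R]_d) : Prop :=
  {ae @lebesgue_measure R, forall t, Iab a b t -> (F t)^T = F t}.

Definition loewner_ge_ae (R : realType) d (a b : R) (F : R -> 'M[R]_d) (mu : R)
  : Prop :=
  {ae @lebesgue_measure R, forall t, Iab a b t ->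
     forall v : 'cV[R]_d, mu * (v^T *m v) ord0 ord0 <= (v^T *m F t *m v) ord0 ord0}.

Definition in_Omega (R : realType) d (a b : R) (P Q W : R -> 'M[R]_d) : Prop :=
  [/\ Linf_mx a b P, Linf_mx a b Q, Linf_mx a b W,
      [/\ symmetric_ae a b P, symmetric_ae a b Q & symmetric_ae a b W] &
      exists mu1 mu2 : R, [/\ 0 < mu1, 0 < mu2,
          loewner_ge_ae a b P mu1 & loewner_ge_ae a b W mu2]].

(* The boundary value problem (omega, [A | B]).
   A solution consists of y and its quasi-derivative z = P y', both
   absolutely continuous on [a,b] (Caratheodory sense), written in
   integrated form:
     y t = y a + int_a^t P^{-1} z,   z t = z a + int_a^t (Q - lambda W) y,
   together with the boundary condition
     (A | B) (-y(a); y(b); z(a); z(b)) = 0.                              *)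

Definition bvals (R : realType) d (a b : R) (y z : R -> 'cV[R[i]]_d)
  : 'cV[R[i]]_((d + d) + (d + d)) :=
  col_mx (col_mx (- y a) (y b)) (col_mx (z a) (z b)).

Definition is_solution (R : realType) d (a b : R) (P Q W : R -> 'M[R]_d)
  (AB : 'M[R[i]]_(d + d, (d + d) + (d + d))) (lam : R)
  (y z : R -> 'cV[R[i]]_d) : Prop :=
  [/\ cintegrable a b (fun s => cmx (invmx (P s)) *m z s),
      cintegrable a b (fun s => cmx (Q s - lam *: W s) *m y s),
      (forall t, Iab a b t ->
         y t = y a + cint_vec a t (fun s => cmx (invmx (P s)) *m z s) /\
         z t = z a + cint_vec a t (fun s => cmx (Q s - lam *: W s) *m y s)) &
      AB *m bvals a b y z = 0].

Definition nontrivial (R : realType) d (a b : R) (y : R -> 'cV[R[i]]_d) : Prop :=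
  exists t, Iab a b t /\ y t != 0.

Definition is_eigenvalue (R : realType) d (a b : R) (P Q W : R -> 'M[R]_d)
  (AB : 'M[R[i]]_(d + d, (d + d) + (d + d))) (lam : R) : Prop :=
  exists y z, is_solution a b P Q W AB lam y z /\ nontrivial a b y.

Definition is_simple_eigenvalue (R : realType) d (a b : R) (P Q W : R -> 'M[R]_d)
  (AB : 'M[R[i]]_(d + d, (d + d) + (d + d))) (lam : R) : Prop :=
  exists y0 z0, [/\ is_solution a b P Q W AB lam y0 z0, nontrivial a b y0 &
    forall y z, is_solution a b P Q W AB lam y z ->
      exists c : R[i], forall t, Iab a b t -> y t = c *: y0 t].

(* The chart O_K: the boundary condition [A | B] whose representative has
   columns a_i = -e_i, b_i = s_i (i in K), a_i = s_i, b_i = e_i (i notin K). *)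

Definition bc_of (R : realType) d (K : {set 'I_(d + d)}) (S : 'M[R[i]]_(d + d))
  : 'M[R[i]]_(d + d, (d + d) + (d + d)) :=
  row_mx (\matrix_(j, i) (if i \in K then - ((j == i)%:R) else S j i))
         (\matrix_(j, i) (if i \in K then S j i else (j == i)%:R)).

Definition mx_close (R : realType) n (B B' : 'M[R[i]]_n) (r : R) : Prop :=
  forall i j, Normc.normc (B i j - B' i j) < r.

(* U is a neighbourhood of S in the space of Hermitian matrices (= O_K) *)
Definition herm_nbhd (R : realType) n (U : set 'M[R[i]]_n) (S : 'M[R[i]]_n) : Prop :=
  (forall B, U B -> is_herm B) /\
  exists del : R, 0 < del /\ forall B, is_herm B -> mx_close B S del -> U B.

Definition continuous_on_herm (R : realType) n (U : set 'M[R[i]]_n)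
  (L : 'M[R[i]]_n -> R) : Prop :=
  forall B, U B -> forall eps : R, 0 < eps -> exists del : R, 0 < del /\
    forall B', U B' -> mx_close B' B del -> `|L B' - L B| < eps.

Definition simple_eigen_branch (R : realType) d (a b : R) (P Q W : R -> 'M[R]_d)
  (K : {set 'I_(d + d)}) (S0 : 'M[R[i]]_(d + d)) (lam_s : R)
  (U : set 'M[R[i]]_(d + d)) (L : 'M[R[i]]_(d + d) -> R) : Prop :=
  [/\ herm_nbhd U S0, continuous_on_herm U L, L S0 = lam_s &
    exists r1 r2 : R, [/\ r1 < lam_s < r2,
      (forall lam, r1 <= lam <= r2 -> is_eigenvalue a b P Q W (bc_of K S0) lam ->
          lam = lam_s) &
      forall B, U B ->
        [/\ r1 < L B < r2, is_simple_eigenvalue a b P Q W (bc_of K B) (L B) &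
          forall lam, r1 < lam < r2 -> is_eigenvalue a b P Q W (bc_of K B) lam ->
            lam = L B]]].

Definition uvec (R : realType) d (K : {set 'I_(d + d)}) (a b : R)
  (y z : R -> 'cV[R[i]]_d) : 'cV[R[i]]_(d + d) :=
  \col_i (if i \in K then col_mx (z a) (z b) i ord0
          else col_mx (- y a) (y b) i ord0).

(* Main.v *)
(* The key is the exact increment formula: if (y, z) and (y', z') solve the
   problems with boundary matrices S, S + H and eigenvalues lam, lam', the
   Lagrange identity gives (lam' - lam) int y^* W y' = u^* H u'.  It remains to
   see that eigenfunctions y' for small H can be rescaled to be uniformly close
   to y, together with their quasi-derivatives.  Were this false, normalized
   initial values along a sequence H -> 0 would have a cluster point; by a
   Gronwall estimate the solutions converge uniformly to a nontrivial solution
   of the limit problem, which by simplicity is a multiple of (y, z), a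
   contradiction. *)
Require Import Defs.
From HB Require Import structures.
From mathcomp Require Import all_boot all_order all_algebra.
From mathcomp Require Import all_classical all_reals all_analysis.
From mathcomp Require Import measurable_realfun complex.
From mathcomp Require Import ring lra.

Set Implicit Arguments.
Unset Strict Implicit.
Unset Printing Implicit Defensive.

Import Order.TTheory GRing.Theory Num.Theory.
Import numFieldNormedType.Exports.

Local Open Scope classical_set_scope.
Local Open Scope ring_scope.
Local Open Scope complex_scope.

(** Qualitative closeness of y' to y suffices because the factor H in u^* H u' is already of size r:
    if u' is near u, the error u^* H (u' - u) is o(r). The other factor I = int y^* W y' multiplies
    the unknown lam' - lam; once |I - 1| <= 1/2 it can be absorbed, giving lam' - lam = O(r) and
    then (lam' - lam)(I - 1) = o(r). The coefficients are only essentially bounded, so derivatives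
    exist only almost everywhere and all equations stay integrated. Coercivity of P bounds the
    entries of P^{-1}, hence solutions are Lipschitz; this supplies their measurability and, through
    quadratically small increments, the product rule behind the Lagrange identity. Perturbed
    eigenfunctions come from the branch itself, and the limit solution is built from actual
    solutions with an explicit error c / (k + 1). Simplicity speaks of y alone, so z has to be
    recovered from y, which rests on positivity of the integral of P^{-1}. *)

(** * Modulus, real and imaginary parts of complex numbers *)

Section ComplexNorm.
Variable R : realType.
Implicit Types x y : R[i].
Local Notation normc := (@Normc.normc R).

Lemma normc_ge0 x : 0 <= normc x.
Proof. by case: x => x y; rewrite /Normc.normc sqrtr_ge0. Qed.

Lemma ler_Re_normc x : `|complex.Re x| <= normc x.
Proof.
case: x => x y /=; rewrite /Normc.normc -sqrtr_sqr ler_wsqrtr// lerDl.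
exact: sqr_ge0.
Qed.

Lemma ler_Im_normc x : `|complex.Im x| <= normc x.
Proof.
case: x => x y /=; rewrite /Normc.normc -sqrtr_sqr ler_wsqrtr// lerDr.
exact: sqr_ge0.
Qed.

Lemma normc_le_ReIm x : normc x <= `|complex.Re x| + `|complex.Im x|.
Proof.
case: x => x y /=; rewrite /Normc.normc.
rewrite -[leRHS]ger0_norm ?addr_ge0// -[leRHS]sqrtr_sqr ler_wsqrtr//.
rewrite sqrrD !real_normK ?num_real//.
have := mulr_ge0 (normr_ge0 x) (normr_ge0 y); lra.
Qed.

Lemma normc_conj x : normc x^*%C = normc x.
Proof. by case: x => x y; rewrite /Normc.normc /= sqrrN. Qed.

Lemma normc_real (r : R) : normc r%:C = `|r|.
Proof. by rewrite /Normc.normc /= expr0n /= addr0 sqrtr_sqr. Qed.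

Lemma normc_eq0 x : (normc x == 0) = (x == 0).
Proof.
apply/eqP/eqP => [/Normc.eq0_normc//|->]; exact: Normc.normc0.
Qed.

Lemma ler_normc_sum (I : Type) (s : seq I) (f : I -> R[i]) :
  normc (\sum_(i <- s) f i) <= \sum_(i <- s) normc (f i).
Proof.
elim/big_rec2: _ => [|i x y _ h]; first by rewrite Normc.normc0.
by rewrite (le_trans (le_normcD _ _))// lerD2l.
Qed.

Lemma normc_distC x y : normc (x - y) = normc (y - x).
Proof. by rewrite -normcN opprB. Qed.

Lemma Re_mul x y : complex.Re (x * y) =
  complex.Re x * complex.Re y - complex.Im x * complex.Im y.
Proof. by case: x; case: y. Qed.

Lemma Im_mul x y : complex.Im (x * y) =
  complex.Re x * complex.Im y + complex.Im x * complex.Re y.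
Proof. by case: x => a b; case: y => c d /=. Qed.

Lemma Re_add x y : complex.Re (x + y) = complex.Re x + complex.Re y.
Proof. by case: x; case: y. Qed.

Lemma Im_add x y : complex.Im (x + y) = complex.Im x + complex.Im y.
Proof. by case: x; case: y. Qed.

Lemma complexP x y : complex.Re x = complex.Re y ->
  complex.Im x = complex.Im y -> x = y.
Proof. by case: x => a b; case: y => c e /= -> ->. Qed.

End ComplexNorm.

(** * Measurability and integration of complex functions on segments *)

Section ComplexIntegral.
Variable R : realType.
Local Notation normc := (@Normc.normc R).
Local Notation mu := (@lebesgue_measure R).
Implicit Types (a b s t M : R) (f g : R -> R[i]) (c : R[i]).

Definition cmeas a b f :=
  measurable_fun `[a, b]%classic (fun x => complex.Re (f x)) /\
  measurable_fun `[a, b]%classic (fun x => complex.Im (f x)).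

Definition cintg a b f :=
  mu.-integrable `[a, b]%classic (EFin \o (fun x => complex.Re (f x))) /\
  mu.-integrable `[a, b]%classic (EFin \o (fun x => complex.Im (f x))).

Definition ae_bd a b f M :=
  {ae mu, forall x, `[a, b]%classic x -> normc (f x) <= M}.

Lemma ae_imp (P Q : R -> Prop) : (forall x, P x -> Q x) ->
  {ae mu, forall x, P x} -> {ae mu, forall x, Q x}.
Proof. by move=> PQ hP; apply: (@filterS _ _ (ae_filter_ringOfSetsType _)) hP. Qed.

Lemma ae_imp2 (P Q S : R -> Prop) : (forall x, P x -> Q x -> S x) ->
  {ae mu, forall x, P x} -> {ae mu, forall x, Q x} -> {ae mu, forall x, S x}.
Proof.
move=> PQ hP hQ; apply: (@filterS2 _ _ (ae_filter_ringOfSetsType _)) hP hQ.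
exact: PQ.
Qed.

Lemma integrable_segD a b (f g : R -> R) :
  mu.-integrable `[a, b]%classic (EFin \o f) ->
  mu.-integrable `[a, b]%classic (EFin \o g) ->
  mu.-integrable `[a, b]%classic (EFin \o (fun x => f x + g x)).
Proof.
by move=> hf hg; apply: eq_integrable (integrableD _ hf hg).
Qed.

Lemma integrable_segZ a b (k : R) (f : R -> R) :
  mu.-integrable `[a, b]%classic (EFin \o f) ->
  mu.-integrable `[a, b]%classic (EFin \o (fun x => k * f x)).
Proof.
by move=> hf; apply: eq_integrable (integrableZl _ _ hf).
Qed.

Lemma integrable_segS a b s t (f : R -> R) : a <= s -> t <= b ->
  mu.-integrable `[a, b]%classic (EFin \o f) ->
  mu.-integrable `[s, t]%classic (EFin \o f).
Proof.
move=> as_ tb; apply: integrableS => // x /=.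
rewrite !in_itv /= => /andP[sx xt].
by rewrite (le_trans as_ sx) (le_trans xt tb).
Qed.

Lemma cintg_meas a b f : cintg a b f -> cmeas a b f.
Proof.
by move=> [/integrableP[h1 _] /integrableP[h2 _]]; split;
  apply/measurable_EFinP.
Qed.

Lemma cmeas_cst a b c : cmeas a b (fun=> c).
Proof. by split; exact: measurable_cst. Qed.

Lemma cmeasD a b f g : cmeas a b f -> cmeas a b g -> cmeas a b (f \+ g).
Proof.
move=> [f1 f2] [g1 g2]; split.
  rewrite (_ : (fun x => _) = fun x => complex.Re (f x) + complex.Re (g x)).
    exact: measurable_funD.
  by apply/funext => x; rewrite Re_add.
rewrite (_ : (fun x => _) = fun x => complex.Im (f x) + complex.Im (g x)).
  exact: measurable_funD.
by apply/funext => x; rewrite Im_add.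
Qed.

Lemma cmeasM a b f g : cmeas a b f -> cmeas a b g -> cmeas a b (f \* g).
Proof.
move=> [f1 f2] [g1 g2]; split.
  rewrite (_ : (fun x => _) = fun x => complex.Re (f x) * complex.Re (g x)
      - complex.Im (f x) * complex.Im (g x)).
    by apply: measurable_funB; exact: measurable_funM.
  by apply/funext => x; rewrite Re_mul.
rewrite (_ : (fun x => _) = fun x => complex.Re (f x) * complex.Im (g x)
    + complex.Im (f x) * complex.Re (g x)).
  by apply: measurable_funD; exact: measurable_funM.
by apply/funext => x; rewrite Im_mul.
Qed.

Lemma cmeas_conj a b f : cmeas a b f -> cmeas a b (fun x => (f x)^*%C).
Proof.
move=> [f1 f2]; split.
  rewrite (_ : (fun x => _) = fun x => complex.Re (f x))//.
  by apply/funext => x; case: (f x).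
rewrite (_ : (fun x => _) = fun x => - complex.Im (f x)).
  exact: measurableT_comp.
by apply/funext => x; case: (f x).
Qed.

Lemma cmeas_sum a b (I : Type) (r : seq I) (f : I -> R -> R[i]) :
  (forall i, cmeas a b (f i)) -> cmeas a b (fun x => \sum_(i <- r) f i x).
Proof.
move=> mf; elim: r => [|i r ih].
  by under eq_fun do rewrite big_nil; exact: cmeas_cst.
by under eq_fun do rewrite big_cons; exact: cmeasD.
Qed.

Lemma cmeas_lim a b (f_ : nat -> R -> R[i]) f :
  (forall n, cmeas a b (f_ n)) ->
  (forall x, `[a, b]%classic x ->
     forall e : R, 0 < e -> exists N, forall n, (N <= n)%N ->
       normc (f_ n x - f x) < e) ->
  cmeas a b f.
Proof.
move=> mf fc; split.
- apply: (@measurable_fun_cvg _ _ _ _ (fun n x => complex.Re (f_ n x))) => [n|].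
    by case: (mf n).
  move=> x /fc {}fc; apply/cvgrPdist_lt => e /fc[N hN].
  exists N => // n /= /hN; apply: le_lt_trans; rewrite normc_distC.
  have -> : complex.Re (f x) - complex.Re (f_ n x) = complex.Re (f x - f_ n x).
    by case: (f x); case: (f_ n x).
  exact: ler_Re_normc.
- apply: (@measurable_fun_cvg _ _ _ _ (fun n x => complex.Im (f_ n x))) => [n|].
    by case: (mf n).
  move=> x /fc {}fc; apply/cvgrPdist_lt => e /fc[N hN].
  exists N => // n /= /hN; apply: le_lt_trans; rewrite normc_distC.
  have -> : complex.Im (f x) - complex.Im (f_ n x) = complex.Im (f x - f_ n x).
    by case: (f x); case: (f_ n x).
  exact: ler_Im_normc.
Qed.

Lemma cintgS a b s t f : a <= s -> t <= b -> cintg a b f -> cintg s t f.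
Proof.
by move=> as_ tb [h1 h2]; split; exact: integrable_segS as_ tb _.
Qed.

Lemma ae_bdS a b s t f M : a <= s -> t <= b -> ae_bd a b f M -> ae_bd s t f M.
Proof.
move=> as_ tb; apply: ae_imp => x h /=; rewrite in_itv /= => /andP[sx xt].
by apply: h; rewrite /= in_itv /= (le_trans as_ sx) (le_trans xt tb).
Qed.

Lemma cintg0 a b : cintg a b (fun=> 0).
Proof.
by split; apply: (eq_integrable _ (cst 0%E)) => //; exact: integrable0.
Qed.

Lemma cintgD a b f g : cintg a b f -> cintg a b g -> cintg a b (f \+ g).
Proof.
move=> [f1 f2] [g1 g2]; split.
  by apply: eq_integrable (integrable_segD f1 g1) => // x _; rewrite /= Re_add.
by apply: eq_integrable (integrable_segD f2 g2) => // x _; rewrite /= Im_add.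
Qed.

Lemma cintgZ a b c f : cintg a b f -> cintg a b (fun x => c * f x).
Proof.
move=> [f1 f2]; split.
  apply: eq_integrable (integrable_segD (integrable_segZ (complex.Re c) f1)
    (integrable_segZ (- complex.Im c) f2)) => // x _.
  by rewrite /= Re_mul mulNr.
apply: eq_integrable (integrable_segD (integrable_segZ (complex.Re c) f2)
  (integrable_segZ (complex.Im c) f1)) => // x _.
by rewrite /= Im_mul.
Qed.

Lemma cintgB a b f g : cintg a b f -> cintg a b g -> cintg a b (f \- g).
Proof.
move=> hf hg; have := cintgD hf (cintgZ (-1) hg).
by congr (cintg a b _); apply/funext => x /=; rewrite mulN1r.
Qed.

Lemma cintg_sum a b (I : Type) (r : seq I) (f : I -> R -> R[i]) :
  (forall i, cintg a b (f i)) -> cintg a b (fun x => \sum_(i <- r) f i x).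
Proof.
move=> mf; elim: r => [|i r ih].
  by under eq_fun do rewrite big_nil; exact: cintg0.
by under eq_fun do rewrite big_cons; exact: cintgD.
Qed.

Lemma cint0 a t : cint a t (fun=> 0 : R[i]) = 0.
Proof. by rewrite /cint /= !Rintegral_cst// !mul0r. Qed.

Lemma cintD a t f g : cintg a t f -> cintg a t g ->
  cint a t (f \+ g) = cint a t f + cint a t g.
Proof.
move=> [f1 f2] [g1 g2]; rewrite /cint.
under eq_Rintegral do rewrite /= Re_add.
under [X in Complex _ X]eq_Rintegral do rewrite /= Im_add.
by rewrite !RintegralD.
Qed.

Lemma cintZ a t c f : cintg a t f -> cint a t (fun x => c * f x) = c * cint a t f.
Proof.
move=> [f1 f2]; rewrite /cint.
under eq_Rintegral do rewrite /= Re_mul.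
under [X in Complex _ X]eq_Rintegral do rewrite /= Im_mul.
rewrite RintegralB ?RintegralD//; [|exact: integrable_segZ..].
by rewrite !RintegralZl//; apply: complexP; rewrite ?Re_mul ?Im_mul.
Qed.

Lemma cintB a t f g : cintg a t f -> cintg a t g ->
  cint a t (f \- g) = cint a t f - cint a t g.
Proof.
move=> hf hg.
rewrite -(mulN1r (cint a t g)) -cintZ// -cintD//; last exact: cintgZ.
by congr cint; apply/funext => x /=; rewrite mulN1r.
Qed.

Lemma cint_sum a t (I : Type) (r : seq I) (f : I -> R -> R[i]) :
  (forall i, cintg a t (f i)) ->
  cint a t (fun x => \sum_(i <- r) f i x) = \sum_(i <- r) cint a t (f i).
Proof.
move=> mf; elim: r => [|i r ih].
  by under eq_fun do rewrite big_nil; rewrite big_nil cint0.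
under eq_fun do rewrite big_cons.
by rewrite big_cons -ih -cintD//; exact: cintg_sum.
Qed.

Lemma cint_split a s t f : a <= s -> s <= t -> cintg a t f ->
  cint a t f = cint a s f + cint s t f.
Proof.
move=> as_ st hf.
have key (h : R -> R) : mu.-integrable `[a, t]%classic (EFin \o h) ->
    \int[mu]_(x in `[a, t]%classic) h x =
    \int[mu]_(x in `[a, s]%classic) h x + \int[mu]_(x in `[s, t]%classic) h x.
  (* Subtracting integrals over closed segments leaves []s, t]], which differs from [[s, t]] by a
     null point. *)
  move=> ih; rewrite -[X in _ + X]Rintegral_itv_obnd_cbnd.
    by rewrite -(@Rintegral_itvB _ _ (BLeft a)) ?bnd_simp// addrC subrK.
  apply: integrableS ih => // x /=; rewrite !in_itv /= => /andP[sx ->].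
  by rewrite (le_trans as_ (ltW sx)).
by case: hf => h1 h2; rewrite /cint !key//.
Qed.

Lemma lebesgue_segment s t : s <= t ->
  mu `[s, t]%classic = (t - s)%:E.
Proof.
move=> st; rewrite lebesgue_measure_itv /= lte_fin.
by case: ltgtP st => // -> _; rewrite subrr.
Qed.

(** Comparison with a constant gives integrability and the estimate at once. The constant is [|M|]
    so that it is nonnegative without a sign condition on [M]. *)
Lemma le_Rintegral_aebd s t M (f : R -> R) : s <= t ->
  measurable_fun `[s, t]%classic f ->
  {ae mu, forall x, `[s, t]%classic x -> `|f x| <= M} ->
  mu.-integrable `[s, t]%classic (EFin \o f) /\
  `|\int[mu]_(x in `[s, t]%classic) f x| <= `|M| * (t - s).
Proof.
move=> st mf bf.
have ub : (\int[mu]_(x in `[s, t]%classic) `|(f x)%:E| <= (`|M| * (t - s))%:E)%E.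
  have bf' : {ae mu, forall x, `[s, t]%classic x ->
      (`|(f x)%:E| <= (cst `|M|%:E) x)%E}.
    apply: ae_imp bf => x h /h; rewrite lee_fin => h'.
    by rewrite (le_trans h')// ler_norm.
  have mf' : measurable_fun `[s, t]%classic (fun x => `|(f x)%:E|%E).
    by apply: measurableT_comp => //; exact/measurable_EFinP.
  rewrite EFinM -lebesgue_segment// -integral_cst//.
  apply: ae_ge0_le_integral => //.
  by move=> x _; rewrite /cst lee_fin.
have fi : mu.-integrable `[s, t]%classic (EFin \o f).
  apply/integrableP; split; first exact/measurable_EFinP.
  by apply: le_lt_trans ub _; exact: ltry.
split=> //; rewrite -lee_fin EFin_normr_Rintegral//; apply: le_trans ub.
by apply: le_abse_integral => //; exact/measurable_EFinP.
Qed.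

Lemma cmeas_ae_bd_cintg s t M f : s <= t -> cmeas s t f -> ae_bd s t f M ->
  cintg s t f.
Proof.
move=> st [m1 m2] bf; split.
  apply: (@le_Rintegral_aebd s t M _ st m1 _).1.
  by apply: ae_imp bf => x h /h; apply: le_trans; exact: ler_Re_normc.
apply: (@le_Rintegral_aebd s t M _ st m2 _).1.
by apply: ae_imp bf => x h /h; apply: le_trans; exact: ler_Im_normc.
Qed.

(** The factor 2 is the price of estimating real and imaginary parts separately; it reappears in
    [prim_lip] and in the constants of [gronwall]. *)
Lemma cint_bound s t M f : s <= t -> 0 <= M -> cintg s t f -> ae_bd s t f M ->
  normc (cint s t f) <= 2 * M * (t - s).
Proof.
move=> st M0 /cintg_meas[m1 m2] bf.
apply: le_trans (normc_le_ReIm _) _; rewrite -mulrA mulr_natl mulr2n.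
rewrite -{1 2}(ger0_norm M0); apply: lerD.
  apply: (@le_Rintegral_aebd s t M _ st m1 _).2.
  by apply: ae_imp bf => x h /h; apply: le_trans; exact: ler_Re_normc.
apply: (@le_Rintegral_aebd s t M _ st m2 _).2.
by apply: ae_imp bf => x h /h; apply: le_trans; exact: ler_Im_normc.
Qed.

Lemma cint_ae_eq s t f g : cmeas s t f -> cmeas s t g ->
  {ae mu, forall x, `[s, t]%classic x -> f x = g x} ->
  cint s t f = cint s t g.
Proof.
move=> [f1 f2] [g1 g2] fg; congr Complex; congr fine; apply: ae_eq_integral => //.
- exact/measurable_EFinP.
- exact/measurable_EFinP.
- by apply: ae_imp fg => x h /h /= ->.
- exact/measurable_EFinP.
- exact/measurable_EFinP.
- by apply: ae_imp fg => x h /h /= ->.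
Qed.

Lemma eq_cint s t f g : (forall x, s <= x <= t -> f x = g x) ->
  cint s t f = cint s t g.
Proof.
by move=> fg; congr Complex; apply: eq_Rintegral => x;
  rewrite inE /= in_itv /= => /fg ->.
Qed.

Lemma eq_cintg s t f g : (forall x, s <= x <= t -> f x = g x) ->
  cintg s t f -> cintg s t g.
Proof.
by move=> fg [h1 h2]; split; [apply: eq_integrable h1|apply: eq_integrable h2];
   rewrite // => x; rewrite inE /= in_itv /= => /fg ->.
Qed.

(** The bound is the sum of the L1 norms of both parts over all of [a, b], hence uniform in the
    endpoint and independent of any essential bound on [f]. *)
Lemma cint_abs_bounded a b f : cintg a b f ->
  exists2 M, 0 <= M & forall t, a <= t <= b -> normc (cint a t f) <= M.
Proof.
move=> hf.
have key (h : R -> R) t : t <= b -> mu.-integrable `[a, b]%classic (EFin \o h) ->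
    `|\int[mu]_(x in `[a, t]%classic) h x| <=
    fine (\int[mu]_(x in `[a, b]%classic) `|(h x)%:E|)%E.
  move=> tb ih.
  have sub : `[a, t]%classic `<=` `[a, b]%classic.
    by move=> x /=; rewrite !in_itv /= => /andP[-> /le_trans]; exact.
  have ih' := integrable_segS (lexx a) tb ih.
  rewrite -lee_fin EFin_normr_Rintegral// fineK; last first.
    rewrite ge0_fin_numE ?integral_ge0//.
    by have /integrableP[] := ih.
  apply: le_trans (le_abse_integral _ _ _) _ => //.
    by have /integrableP[] := ih'.
  apply: ge0_subset_integral => //.
  by apply: measurableT_comp => //; have /integrableP[] := ih.
exists (fine (\int[mu]_(x in `[a, b]%classic) `|(complex.Re (f x))%:E|)%E +
  fine (\int[mu]_(x in `[a, b]%classic) `|(complex.Im (f x))%:E|)%E).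
  by rewrite addr_ge0// fine_ge0// integral_ge0.
move=> t /andP[at_ tb]; apply: le_trans (normc_le_ReIm _) _.
by case: hf => h1 h2; rewrite lerD// /cint /= key.
Qed.

End ComplexIntegral.

(** * A norm on complex vectors, and the adjoint *)

Section VectorNorm.
Variable R : realType.
Local Notation normc := (@Normc.normc R).
Local Notation C := R[i].

(** The l1 norm is chosen because it is additive on stacked vectors ([vn_col_mx]), so y and z can be
    merged into one state vector at no cost in constants. *)
Definition vn n (v : 'cV[C]_n) : R := \sum_i normc (v i ord0).

Lemma vn_ge0 n (v : 'cV[C]_n) : 0 <= vn v.
Proof. by apply: sumr_ge0 => i _; exact: normc_ge0. Qed.

Lemma vn0 n : vn (0 : 'cV[C]_n) = 0.
Proof. by rewrite /vn big1// => i _; rewrite mxE Normc.normc0. Qed.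

Lemma ler_vnD n (u v : 'cV[C]_n) : vn (u + v) <= vn u + vn v.
Proof.
by rewrite /vn -big_split /=; apply: ler_sum => i _; rewrite mxE le_normcD.
Qed.

Lemma vnZ n (c : C) (v : 'cV[C]_n) : vn (c *: v) = normc c * vn v.
Proof.
by rewrite /vn mulr_sumr; apply: eq_bigr => i _; rewrite mxE Normc.normcM.
Qed.

Lemma vnN n (v : 'cV[C]_n) : vn (- v) = vn v.
Proof. by apply: eq_bigr => i _; rewrite mxE normcN. Qed.

Lemma vn_distC n (u v : 'cV[C]_n) : vn (u - v) = vn (v - u).
Proof. by rewrite -vnN opprB. Qed.

Lemma ler_vn_dist n (u v w : 'cV[C]_n) : vn (u - w) <= vn (u - v) + vn (v - w).
Proof. by rewrite -(subrK v u) -(addrA (u - v)) (le_trans (ler_vnD _ _))// subrK. Qed.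

Lemma ler_normc_vn n (v : 'cV[C]_n) i : normc (v i ord0) <= vn v.
Proof.
rewrite /vn (bigD1 i)//= lerDl; apply: sumr_ge0 => j _; exact: normc_ge0.
Qed.

Lemma vn_le0 n (v : 'cV[C]_n) : vn v <= 0 -> v = 0.
Proof.
move=> v0; apply/matrixP => i j; rewrite ord1 mxE; apply: Normc.eq0_normc.
by apply/eqP; rewrite eq_le normc_ge0 andbT (le_trans (ler_normc_vn v i)).
Qed.

Lemma ler_vn_bd n (v : 'cV[C]_n) M : (forall i, normc (v i ord0) <= M) ->
  vn v <= n%:R * M.
Proof.
move=> h; apply: le_trans (ler_sum _ (fun i _ => h i)) _.
by rewrite sumr_const card_ord mulr_natl.
Qed.

Lemma ler_vn_mulmx m n (A : 'M[C]_(m, n)) (v : 'cV[C]_n) c :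
  (forall i j, normc (A i j) <= c) -> vn (A *m v) <= m%:R * c * vn v.
Proof.
move=> Ac; rewrite -mulrA; apply: ler_vn_bd => i; rewrite mxE.
apply: le_trans (ler_normc_sum _ _) _; rewrite /vn mulr_sumr.
by apply: ler_sum => j _; rewrite Normc.normcM ler_wpM2r ?normc_ge0.
Qed.

Lemma ler_normc_dot n (u : 'rV[C]_n) (v : 'cV[C]_n) c :
  (forall j, normc (u ord0 j) <= c) -> normc ((u *m v) ord0 ord0) <= c * vn v.
Proof.
move=> Ac; rewrite mxE.
apply: le_trans (ler_normc_sum _ _) _; rewrite /vn mulr_sumr.
by apply: ler_sum => j _; rewrite Normc.normcM ler_wpM2r ?normc_ge0.
Qed.

Lemma vn_col_mx m n (u : 'cV[C]_m) (v : 'cV[C]_n) :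
  vn (col_mx u v) = vn u + vn v.
Proof.
rewrite /vn big_split_ord /=; congr (_ + _); apply: eq_bigr => i _.
  by rewrite col_mxEu.
by rewrite col_mxEd.
Qed.

Lemma adjmxD m n (A B : 'M[C]_(m, n)) : adjmx (A + B) = adjmx A + adjmx B.
Proof. by rewrite /adjmx map_mxD linearD. Qed.

Lemma adjmxN m n (A : 'M[C]_(m, n)) : adjmx (- A) = - adjmx A.
Proof. by rewrite /adjmx map_mxN linearN. Qed.

Lemma adjmxM m n p (A : 'M[C]_(m, n)) (B : 'M[C]_(n, p)) :
  adjmx (A *m B) = adjmx B *m adjmx A.
Proof. by rewrite /adjmx map_mxM trmx_mul. Qed.

Lemma adjmxK m n (A : 'M[C]_(m, n)) : adjmx (adjmx A) = A.
Proof. by apply/matrixP => i j; rewrite !mxE; case: (A i j) => x y; rewrite /= opprK. Qed.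

End VectorNorm.

(** * Primitives, Lipschitz bounds and the product rule *)

Section Primitive.
Variable R : realType.
Local Notation normc := (@Normc.normc R).
Local Notation mu := (@lebesgue_measure R).
Implicit Types (a b s t M : R) (f g : R -> R[i]).

(** Absolute continuity in integrated form: [f1] plays the role of the derivative of [f]. *)
Definition prim a b f f1 :=
  cintg a b f1 /\ forall t, a <= t <= b -> f t = f a + cint a t f1.

Lemma prim_diff a b f f1 s t : prim a b f f1 -> a <= s -> s <= t -> t <= b ->
  f t - f s = cint s t f1.
Proof.
move=> [i1 e] as_ st tb; rewrite e ?(le_trans as_ st)// (e s); last first.
  by rewrite as_ (le_trans st tb).
rewrite (cint_split as_ st); last exact: cintgS i1.
ring.
Qed.

Lemma prim_lip a b f f1 M s t : prim a b f f1 -> 0 <= M -> ae_bd a b f1 M ->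
  a <= s -> s <= t -> t <= b -> normc (f t - f s) <= 2 * M * (t - s).
Proof.
move=> pf M0 bf as_ st tb; rewrite (prim_diff pf)//; apply: cint_bound => //.
  by case: pf => h _; exact: cintgS h.
exact: ae_bdS bf.
Qed.

Lemma prim_bounded a b f f1 : prim a b f f1 ->
  exists2 M, 0 <= M & forall t, a <= t <= b -> normc (f t) <= M.
Proof.
move=> [i1 e]; have [M M0 hM] := cint_abs_bounded i1.
exists (normc (f a) + M); first by rewrite addr_ge0 ?normc_ge0.
move=> t tab; rewrite e// (le_trans (le_normcD _ _))// lerD2l.
exact: hM.
Qed.

(** Precomposing with the projection [cl] of the line onto [a, b] turns a Lipschitz function on the
    segment into a continuous one on the whole line, which agrees with [f] on [a, b]. *)
Lemma lipschitz_seg_measurable a b M (f : R -> R) : a <= b -> 0 <= M ->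
  (forall s t, a <= s -> s <= t -> t <= b -> `|f t - f s| <= M * (t - s)) ->
  measurable_fun `[a, b]%classic f.
Proof.
move=> ab M0 lf.
pose cl x : R := if x <= a then a else if b <= x then b else x.
have clb x : a <= cl x <= b.
  rewrite /cl; case: (lerP x a) => xa; first by rewrite lexx.
  by case: (lerP b x) => bx; rewrite ?lexx ?ab// !ltW.
have cl_le x y : x <= y -> cl x <= cl y /\ cl y - cl x <= y - x.
  rewrite /cl => xy.
  case: (lerP x a) => xa; case: (lerP y a) => ya; case: (lerP b x) => bx;
    case: (lerP b y) => by_; split; lra.
have gl x y : `|f (cl x) - f (cl y)| <= M * `|x - y|.
  wlog xy : x y / y <= x.
    move=> h; have /orP[/h//|/h] := le_total y x.
    by rewrite distrC (distrC y x).
  have [c1 c2] := cl_le _ _ xy.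
  have /andP[? _] := clb y; have /andP[_ ?] := clb x.
  rewrite (le_trans (lf _ _ _ _ _))// ler_wpM2l// (le_trans c2)//.
  exact: ler_norm.
have cg : continuous (f \o cl).
  move=> x; apply/cvgrPdist_lt => e e0; near=> y.
  rewrite /=; apply: le_lt_trans (gl x y) _.
  have : `|x - y| < e / (M + 1).
    (* Dividing by [M + 1] rather than [M] covers [M = 0]. *)
    near: y; apply: (@cvgr_dist_lt _ _ _ (nbhs x)) => //.
    by rewrite divr_gt0// ltr_wpDl.
  rewrite ltr_pdivlMr ?ltr_wpDl// => h; apply: le_lt_trans h.
  by rewrite mulrC ler_wpM2l// lerDl.
have mg : measurable_fun `[a, b]%classic (f \o cl).
  apply: measurable_funS (continuous_measurable_fun cg) => //.
apply: eq_measurable_fun mg => x; rewrite inE /= in_itv /= => /andP[ax xb].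
rewrite /= /cl; case: (lerP x a) => xa; first by congr f; lra.
by case: (lerP b x) => bx//; congr f; lra.
Unshelve. all: by end_near. Qed.

Lemma prim_meas a b f f1 M : a <= b -> prim a b f f1 -> 0 <= M ->
  ae_bd a b f1 M -> cmeas a b f.
Proof.
move=> ab pf M0 bf; have M20 : 0 <= 2 * M by rewrite mulr_ge0.
split; apply: (lipschitz_seg_measurable ab M20) => s t as_ st tb.
  apply: le_trans (prim_lip pf M0 bf as_ st tb).
  apply: le_trans (ler_Re_normc _).
  by case: (f t) => ? ?; case: (f s).
apply: le_trans (prim_lip pf M0 bf as_ st tb).
apply: le_trans (ler_Im_normc _).
by case: (f t) => ? ?; case: (f s).
Qed.

(** Stands in for passing to the limit: errors are carried as bounds of the form c / (N + 1), and an
    identity between limits is proved by bounding the norm of the difference this way. *)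
Lemma le0_of_le_inv (x c : R) : (forall N : nat, x <= c / N.+1%:R) -> x <= 0.
Proof.
move=> h; rewrite leNgt; apply/negP => x0.
(* The sign of [c] follows from the case N = 0, where the bound is [c] itself. *)
have c0 : 0 <= c by rewrite ltW// (lt_le_trans x0)// (le_trans (h 0%N))// divr1.
have := archi_boundP (divr_ge0 c0 (ltW x0)).
set N := Num.Def.archi_bound _ => hN; have := h N.
rewrite leNgt => /negP; apply; rewrite ltr_pdivrMr ?ltr0n// mulrC.
rewrite -ltr_pdivrMr//; apply: lt_trans hN _; by rewrite ltr_nat.
Qed.

(** Over N + 1 equal steps the increments add up to at most K (b - a)^2 / (N + 1), which is
    arbitrarily small. This replaces the argument that a function with zero derivative is
    constant. *)
Lemma quadratic_increment_const a b (K : R) (f : R -> R[i]) : a <= b -> 0 <= K ->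
  (forall s t, a <= s -> s <= t -> t <= b -> normc (f t - f s) <= K * (t - s) ^+ 2) ->
  f b = f a.
Proof.
move=> ab K0 h.
have step N : normc (f b - f a) <= K * (b - a) ^+ 2 / N.+1%:R.
  pose d := (b - a) / N.+1%:R.
  have d0 : 0 <= d by rewrite divr_ge0// subr_ge0.
  have dN : a + N.+1%:R * d = b by rewrite /d; field; rewrite addrC natr1 pnatr_eq0.
  have H k : (k <= N.+1)%N ->
      normc (f (a + k%:R * d) - f a) <= k%:R * (K * d ^+ 2).
    elim: k => [_|k ih kN]; first by rewrite mul0r addr0 subrr Normc.normc0 mul0r.
    have := ih (ltnW kN); set s := a + _ => {}ih; set t := a + _.
    have ts : t = s + d by rewrite /t /s -natr1; ring.
    have -> : f t - f a = (f t - f s) + (f s - f a) by rewrite addrA subrK.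
    apply: le_trans (le_normcD _ _) _; rewrite -natr1 mulrDl mul1r addrC lerD//.
    have -> : d = t - s by rewrite ts addrC addKr.
    apply: h.
    - by rewrite /s lerDl mulr_ge0.
    - by rewrite ts lerDl.
    - by rewrite -dN /t lerD2l ler_wpM2r// ler_nat.
  have := H N.+1 (leqnn _); rewrite dN => /le_trans; apply.
  rewrite le_eqVlt; apply/orP; left; apply/eqP.
  by rewrite /d; field; rewrite addrC natr1 pnatr_eq0.
apply/eqP; rewrite -subr_eq0 -normc_eq0 eq_le normc_ge0 andbT.
exact: (le0_of_le_inv step).
Qed.

(* The difference between f g and the integral has increments O((t - s)^2),
   hence is constant. *)
Lemma prod_rule a b f f1 g g1 M : a <= b -> 0 <= M ->
  prim a b f f1 -> prim a b g g1 -> ae_bd a b f1 M -> ae_bd a b g1 M ->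
  cintg a b (fun s => f1 s * g s + f s * g1 s) /\
  f b * g b - f a * g a = cint a b (fun s => f1 s * g s + f s * g1 s).
Proof.
move=> ab M0 pf pg bf bg.
have mf := prim_meas ab pf M0 bf; have mg := prim_meas ab pg M0 bg.
have mf1 := cintg_meas pf.1; have mg1 := cintg_meas pg.1.
have [Bf Bf0 hBf] := prim_bounded pf; have [Bg Bg0 hBg] := prim_bounded pg.
have ifg : cintg a b (fun s => f1 s * g s).
  apply: (@cmeas_ae_bd_cintg _ a b (M * Bg)) => //; first exact: cmeasM.
  apply: ae_imp bf => x h xab; rewrite Normc.normcM ler_pM ?normc_ge0 ?h//.
  by apply: hBg; move: xab; rewrite /= in_itv.
have igf : cintg a b (fun s => f s * g1 s).
  apply: (@cmeas_ae_bd_cintg _ a b (Bf * M)) => //; first exact: cmeasM.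
  apply: ae_imp bg => x h xab; rewrite Normc.normcM ler_pM ?normc_ge0 ?h//.
  by apply: hBf; move: xab; rewrite /= in_itv.
have ii := cintgD ifg igf; split => //.
pose phi t := f t * g t - cint a t (fun s => f1 s * g s + f s * g1 s).
have phia : phi a = f a * g a.
  rewrite /phi; set I := cint _ _ _.
  suff -> : I = 0 by rewrite subr0.
  apply/eqP; rewrite -normc_eq0 eq_le normc_ge0 andbT /I.
  by rewrite /cint set_itv1 !Rintegral_set1 Normc.normc0.
suff : phi b = phi a.
  by rewrite phia => <-; rewrite /phi opprB addrCA subrr addr0.
have M20 : 0 <= M * (2 * M) by rewrite !mulr_ge0.
(* Two integrals, each at most 2 (from [cint_bound]) times M times 2 M (t - s) (from [prim_lip])
   times the length t - s. *)
apply: (@quadratic_increment_const a b (8 * M * M)) => //.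
  by rewrite !mulr_ge0.
move=> s t as_ st tb.
have ts0 : 0 <= t - s by rewrite subr_ge0.
have iS h : cintg a b h -> cintg s t h by apply: cintgS.
(* Write f t g t - f s g s as (f t - f s) g t + f s (g t - g s) and each difference as an integral.
   Every integrand is then a bounded derivative times a Lipschitz difference. *)
have -> : phi t - phi s = cint s t (fun x => f1 x * (g t - g x)) +
    cint s t (fun x => g1 x * (f s - f x)).
  rewrite /phi (cint_split as_ st); last exact: cintgS ii.
  have -> : cint s t (fun x => f1 x * (g t - g x)) =
      g t * (f t - f s) - cint s t (fun x => f1 x * g x).
    rewrite (prim_diff pf)// -cintZ; last exact: iS pf.1.
    rewrite -cintB; [|exact: cintgZ (iS _ pf.1)|exact: iS].
    by apply: eq_cint => x _ /=; ring.
  have -> : cint s t (fun x => g1 x * (f s - f x)) =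
      f s * (g t - g s) - cint s t (fun x => f x * g1 x).
    rewrite (prim_diff pg)// -cintZ; last exact: iS pg.1.
    rewrite -cintB; [|exact: cintgZ (iS _ pg.1)|exact: iS].
    by apply: eq_cint => x _ /=; ring.
  rewrite (_ : cint s t (fun x => _ + _) = cint s t (fun x => f1 x * g x) +
    cint s t (fun x => f x * g1 x)); first by ring.
  by rewrite -cintD//; exact: iS.
apply: le_trans (le_normcD _ _) _.
have -> : 8 * M * M * (t - s) ^+ 2 = 2 * (M * (2 * M * (t - s))) * (t - s) +
  2 * (M * (2 * M * (t - s))) * (t - s) by ring.
apply: lerD; apply: cint_bound => //.
- by rewrite !mulr_ge0.
- apply: (@eq_cintg _ _ _ (fun x => g t * f1 x - f1 x * g x)).
    by move=> x _; ring.
  by apply: cintgB; [exact: cintgZ (iS _ pf.1)|exact: iS].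
- apply: ae_imp (ae_bdS as_ tb bf) => x h xst.
  rewrite Normc.normcM ler_pM ?normc_ge0 ?h//.
  move: xst; rewrite /= in_itv /= => /andP[sx xt].
  apply: le_trans (prim_lip pg M0 bg _ xt tb) _; first exact: le_trans sx.
  by rewrite ler_wpM2l ?mulr_ge0// lerD2l lerN2.
- by rewrite !mulr_ge0.
- apply: (@eq_cintg _ _ _ (fun x => f s * g1 x - f x * g1 x)).
    by move=> x _; ring.
  by apply: cintgB; [exact: cintgZ (iS _ pg.1)|exact: iS].
- apply: ae_imp (ae_bdS as_ tb bg) => x h xst.
  rewrite Normc.normcM ler_pM ?normc_ge0 ?h//.
  move: xst; rewrite /= in_itv /= => /andP[sx xt].
  rewrite normc_distC.
  apply: le_trans (prim_lip pf M0 bf as_ sx _) _; first exact: le_trans tb.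
  by rewrite ler_wpM2l ?mulr_ge0// lerD2r.
Qed.

Lemma prim_conj a b f f1 : prim a b f f1 ->
  prim a b (fun t => (f t)^*%C) (fun t => (f1 t)^*%C).
Proof.
move=> [[i1 i2] e]; split.
  split.
    by apply: eq_integrable i1 => // x _ /=; case: (f1 x).
  apply: eq_integrable (integrable_segZ (-1) i2) => // x _ /=.
  by rewrite mulN1r; case: (f1 x).
move=> t /[dup] /andP[at_ tb] /e ->; rewrite rmorphD; congr (_ + _).
rewrite /cint /=; congr Complex.
  by apply: eq_Rintegral => x _; case: (f1 x).
rewrite -mulN1r -RintegralZl//; last exact: integrable_segS i2.
by apply: eq_Rintegral => x _; rewrite mulN1r; case: (f1 x).
Qed.

End Primitive.

(** * A Gronwall estimate for integrated differential inequalities *)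

Section Gronwall.
Variable R : realType.
Local Notation normc := (@Normc.normc R).
Local Notation mu := (@lebesgue_measure R).
Implicit Types (a b s t M : R).

Lemma ler_vn_cint n s t M (G : R -> 'cV[R[i]]_n) : s <= t -> 0 <= M ->
  (forall i, cintg s t (fun x => G x i ord0)) ->
  {ae mu, forall x, `[s, t]%classic x -> vn (G x) <= M} ->
  vn (cint_vec s t G) <= n%:R * (2 * M * (t - s)).
Proof.
move=> st M0 iG bG; apply: ler_vn_bd => i; rewrite mxE; apply: cint_bound => //.
by apply: ae_imp bG => x h /h; apply: le_trans; exact: ler_normc_vn.
Qed.

(** With [T] the supremum of [f] on [A], the second hypothesis reads sup <= X + sup / 2. The a
    priori bound [B0] makes the supremum finite, so that half of it can be absorbed, and leaves no
    trace in the result. *)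
Lemma self_improving_bound (A : set R) (f : R -> R) (B0 X : R) :
  (forall x, A x -> f x <= B0) ->
  (forall T, (forall x, A x -> f x <= T) -> forall x, A x -> f x <= X + T / 2) ->
  forall x, A x -> f x <= 2 * X.
Proof.
move=> hB hT x Ax; pose E := f @` A.
have E0 : E !=set0 by exists (f x), x.
have sE : has_sup E by split => //; exists B0 => _ [y Ay <-]; exact: hB.
have up y : A y -> f y <= sup E.
  by move=> Ay; apply: (sup_upper_bound sE); exists y.
have : sup E <= X + sup E / 2.
  by apply: ge_sup => // _ [y Ay <-]; exact: hT.
have := up _ Ax; lra.
Qed.

(* On a step of length h with N C h = 1/2 the supremum of |w| is absorbed into
   the left-hand side, so |w| grows at most by a fixed factor per step. *)
Lemma gronwall n a b (C : R) : a <= b -> 0 < C ->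
  exists2 K : R, 0 <= K &
  forall (w G : R -> 'cV[R[i]]_n) (del0 del B0 : R), 0 <= del ->
  (forall i, cintg a b (fun x => G x i ord0)) ->
  (forall t, a <= t <= b -> w t = w a + cint_vec a t G) ->
  (forall t, a <= t <= b -> vn (w t) <= B0) ->
  {ae mu, forall x, `[a, b]%classic x -> vn (G x) <= C * vn (w x) + del} ->
  vn (w a) <= del0 ->
  forall t, a <= t <= b -> vn (w t) <= K * (del0 + del).
Proof.
(* 2 n is the constant of [ler_vn_cint]; the added 1 keeps [N] positive when n = 0. *)
move=> ab C0; pose N : R := 2 * n%:R + 1.
have N0 : 0 < N by rewrite ltr_wpDl// mulr_ge0.
pose h := (2 * N * C)^-1.
have h0 : 0 < h by rewrite invr_gt0 !mulr_gt0.
have NCh : N * C * h = 2^-1.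
  rewrite /h; field; apply/andP; split; exact: lt0r_neq0.
pose m := Num.Def.archi_bound ((b - a) / h).
have hm : b <= a + m%:R * h.
  rewrite -lerBlDl -ler_pdivrMr// ltW// archi_boundP//.
  by rewrite divr_ge0 ?subr_ge0// ltW.
(* One step doubles the bound and adds 2 N h del, which is at most [E] below; so it at most triples,
   and [m] steps cover [a, b]. *)
exists (3 ^+ m * (1 + 2 * N * h)).
  by rewrite mulr_ge0 ?exprn_ge0// addr_ge0// !mulr_ge0// ltW.
move=> w G del0 del B0 del_ge0 iG ew bw bG wa.
have wa0 : 0 <= del0 by exact: le_trans (vn_ge0 _) wa.
have diff s t : a <= s -> s <= t -> t <= b -> w t = w s + cint_vec s t G.
  move=> as_ st tb; apply/matrixP => i j; rewrite ord1 mxE [X in _ + X]mxE.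
  have pi : prim a b (fun x => w x i ord0) (fun x => G x i ord0).
    by split=> // x /ew {1}->; rewrite !mxE.
  by rewrite -(prim_diff pi as_ st tb) addrC subrK.
have step s t : a <= s -> s <= t -> t <= s + h -> t <= b ->
    vn (w t) <= 2 * (vn (w s) + N * del * h).
  move=> as_ st tsh tb.
  pose A := [set x | s <= x <= t].
  apply: (@self_improving_bound A (fun x => vn (w x)) B0); last 1 first.
  - by rewrite /A /= st lexx.
  - by move=> x /andP[sx xt]; apply: bw; rewrite (le_trans as_ sx) (le_trans xt tb).
  move=> T hT x /andP[sx xt].
  have T0 : 0 <= T by apply: le_trans (vn_ge0 _) (hT s _); rewrite /A /= lexx st.
  have xb := le_trans xt tb.
  rewrite (diff s x)//; apply: le_trans (ler_vnD _ _) _; rewrite -addrA lerD2l.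
  have CT0 : 0 <= C * T + del by rewrite addr_ge0// mulr_ge0// ltW.
  apply: (@le_trans _ _ (n%:R * (2 * (C * T + del) * (x - s)))).
    apply: ler_vn_cint => //.
      by move=> i; exact: cintgS (iG i).
    apply: ae_imp bG => z hz; rewrite /= in_itv /= => /andP[sz zx].
    have zab : a <= z <= b by rewrite (le_trans as_ sz) (le_trans zx xb).
    have := hz zab => /le_trans; apply.
    rewrite lerD2r ler_wpM2l ?(ltW C0)// hT// /A /= sz; exact: le_trans xt.
  have xs0 : 0 <= x - s by rewrite subr_ge0.
  have xsh : x - s <= h by rewrite lerBlDl (le_trans xt).
  apply: (@le_trans _ _ (N * (C * T + del) * h)).
    have -> : n%:R * (2 * (C * T + del) * (x - s)) =
      ((2 * n%:R) * (C * T + del)) * (x - s) by ring.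
    apply: ler_pM => //; first by rewrite !mulr_ge0.
    by rewrite ler_wpM2r// /N lerDl.
  have -> : N * (C * T + del) * h = (N * C * h) * T + N * del * h by ring.
  by rewrite NCh addrC mulrC.
pose E := del0 + 2 * N * h * del.
have E1 : del0 <= E by rewrite /E lerDl !mulr_ge0// ltW.
have E0 : 0 <= E by exact: le_trans E1.
have ind k t : a <= t <= b -> t <= a + k%:R * h -> vn (w t) <= 3 ^+ k * E.
  elim: k t => [|k ih] t /[dup] tab /andP[at_ tb].
    rewrite mul0r addr0 => ta; have -> : t = a by apply/le_anti; rewrite ta.
    by rewrite expr0 mul1r (le_trans wa).
  move=> tk; have [tk'|/ltW tk'] := leP t (a + k%:R * h).
    rewrite (le_trans (ih _ tab tk'))// ler_wpM2r// exprS.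
    by rewrite ler_peMl ?exprn_ge0// ler1n.
  set s := a + k%:R * h in tk' *.
  have as_ : a <= s by rewrite /s lerDl mulr_ge0// ltW.
  have ws : vn (w s) <= 3 ^+ k * E.
    by apply: ih => //; rewrite as_ (le_trans tk' tb).
  have tsh : t <= s + h by rewrite (le_trans tk)// /s -natr1; lra.
  have := step _ _ as_ tk' tsh tb => /le_trans; apply.
  have p1 : E <= 3 ^+ k * E by rewrite ler_peMl// exprn_ege1// ler1n.
  have p2 : 2 * N * h * del <= E by rewrite /E lerDr.
  rewrite exprS; have : 2 * (N * del * h) = 2 * N * h * del by ring.
  lra.
move=> t /[dup] tab /andP[at_ tb].
apply: le_trans (ind m _ tab (le_trans tb hm)) _.
rewrite -mulrA ler_wpM2l ?exprn_ge0// /E.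
have Nh0 : 0 <= 2 * N * h by rewrite !mulr_ge0// ltW.
have := mulr_ge0 Nh0 wa0; lra.
Qed.

End Gronwall.

(** * Linear systems in integrated form *)

Section LinearSystem.
Variable R : realType.
Local Notation normc := (@Normc.normc R).
Local Notation mu := (@lebesgue_measure R).
Variables (n : nat) (a b : R).
Hypothesis ab : a <= b.
Implicit Types (s t M : R) (w v : R -> 'cV[R[i]]_n) (F : R -> 'M[R[i]]_n).

Definition lsol F w :=
  (forall i, cintg a b (fun s => (F s *m w s) i ord0)) /\
  forall t, a <= t <= b -> w t = w a + cint_vec a t (fun s => F s *m w s).

Definition mx_aebd F M :=
  {ae mu, forall s, `[a, b]%classic s -> forall i j, normc (F s i j) <= M}.

Lemma lsol_prim F w i : lsol F w ->
  prim a b (fun t => w t i ord0) (fun s => (F s *m w s) i ord0).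
Proof. by move=> [h e]; split => // t /e {1}->; rewrite !mxE. Qed.

Lemma lsol_bounded F w : lsol F w ->
  exists2 B, 0 <= B & forall t, a <= t <= b -> vn (w t) <= B.
Proof.
move=> hw.
have /choice[B hB] : forall i, exists M, 0 <= M /\
    forall t, a <= t <= b -> normc (w t i ord0) <= M.
  by move=> i; have [M M0 hM] := prim_bounded (lsol_prim i hw); exists M.
exists (\sum_i B i); first by apply: sumr_ge0 => i _; case: (hB i).
by move=> t tab; apply: ler_sum => i _; apply: (hB i).2.
Qed.

(** A solution is bounded, so its derivative F w is essentially bounded; this is the input that
    [prim_meas] and [prod_rule] ask for. *)
Lemma lsol_deriv_aebd F w M : mx_aebd F M -> lsol F w -> 0 <= M ->
  exists2 B, 0 <= B & forall i, ae_bd a b (fun s => (F s *m w s) i ord0) B.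
Proof.
move=> bF hw M0; have [B B0 hB] := lsol_bounded hw.
exists (n%:R * M * B); first by rewrite !mulr_ge0.
move=> i; apply: ae_imp bF => s h sab.
apply: le_trans (ler_normc_vn _ _) _.
apply: le_trans (ler_vn_mulmx _ (h sab)) _.
by rewrite ler_wpM2l ?mulr_ge0// hB//; move: sab; rewrite /= in_itv.
Qed.

Lemma lsolZ F w c : lsol F w -> lsol F (fun t => c *: w t).
Proof.
move=> [iw ew].
have e s i : (F s *m (c *: w s)) i ord0 = c * (F s *m w s) i ord0.
  by rewrite -scalemxAr mxE.
split.
  by move=> i; under eq_fun do rewrite e; exact: cintgZ.
move=> t /[dup] /andP[_ tb] /ew {1}->; rewrite scalerDr; congr (_ + _).
apply/matrixP => i j; rewrite !mxE -cintZ; last exact: cintgS (iw i).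
by apply: eq_cint => s _; rewrite e.
Qed.

Lemma lsolB F w v : lsol F w -> lsol F v -> lsol F (fun t => w t - v t).
Proof.
move=> [iw ew] [iv ev].
have e s i : (F s *m (w s - v s)) i ord0 =
    (F s *m w s) i ord0 - (F s *m v s) i ord0 by rewrite mulmxBr !mxE.
split.
  by move=> i; under eq_fun do rewrite e; exact: cintgB.
move=> t /[dup] tab /andP[_ tb]; rewrite ew// ev//.
apply/matrixP => i j; rewrite !mxE.
have -> : cint a t (fun s => (F s *m (w s - v s)) i ord0) =
   cint a t (fun s => (F s *m w s) i ord0) - cint a t (fun s => (F s *m v s) i ord0).
  rewrite -cintB; [|exact: cintgS (iw i)|exact: cintgS (iv i)].
  by apply: eq_cint => s _; rewrite e.
ring.
Qed.

End LinearSystem.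

(** * Limits of Cauchy sequences with an explicit rate *)

Section CauchyRate.
Variable R : realType.
Local Notation normc := (@Normc.normc R).

(** The hypothesis says that the intervals of centre u k and radius c / (k + 1) meet pairwise; the
    supremum of their left ends lies in all of them. *)
Lemma real_cauchy_rate (u : nat -> R) (c : R) :
  (forall k l, `|u k - u l| <= c * (k.+1%:R^-1 + l.+1%:R^-1)) ->
  exists x, forall k, `|u k - x| <= c * k.+1%:R^-1.
Proof.
move=> h; pose E := [set u k - c * k.+1%:R^-1 | k in [set: nat]].
have le k l : u k - c * k.+1%:R^-1 <= u l + c * l.+1%:R^-1.
  have := h k l; rewrite mulrDr => /(le_trans (ler_norm _)).
  by move: (c * _) (c * _) => p q; lra.
have E0 : E !=set0 by exists (u 0%N - c * 1%:R^-1), 0%N.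
have sE : has_sup E.
  by split => //; exists (u 0%N + c * 1%:R^-1) => _ [k _ <-]; exact: le.
exists (sup E) => k.
have h1 : u k - c * k.+1%:R^-1 <= sup E.
  by apply: (sup_upper_bound sE); exists k.
have h2 : sup E <= u k + c * k.+1%:R^-1.
  by apply: ge_sup => // _ [l _ <-]; exact: le.
move: h1 h2; move: (c * _) => p h1 h2.
by rewrite ler_norml; apply/andP; split; lra.
Qed.

Lemma vec_cauchy_rate n (u : nat -> 'cV[R[i]]_n) (c : R) :
  (forall k l, vn (u k - u l) <= c * (k.+1%:R^-1 + l.+1%:R^-1)) ->
  exists x, forall k, vn (u k - x) <= (n%:R * (2 * c)) * k.+1%:R^-1.
Proof.
move=> h.
have /choice[re hre] : forall i, exists x, forall k,
    `|complex.Re (u k i ord0) - x| <= c * k.+1%:R^-1.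
  move=> i; apply: real_cauchy_rate => k l.
  apply: le_trans (h k l); apply: le_trans (ler_normc_vn _ i).
  apply: le_trans (ler_Re_normc _); rewrite !mxE.
  by case: (u k i ord0) => ? ?; case: (u l i ord0).
have /choice[im him] : forall i, exists x, forall k,
    `|complex.Im (u k i ord0) - x| <= c * k.+1%:R^-1.
  move=> i; apply: real_cauchy_rate => k l.
  apply: le_trans (h k l); apply: le_trans (ler_normc_vn _ i).
  apply: le_trans (ler_Im_normc _); rewrite !mxE.
  by case: (u k i ord0) => ? ?; case: (u l i ord0).
exists (\col_i Complex (re i) (im i)) => k.
rewrite -mulrA; apply: ler_vn_bd => i; rewrite !mxE.
apply: le_trans (normc_le_ReIm _) _.
have := hre i k; have := him i k.
rewrite -mulrA; move: (c * _) => p.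
by case: (u k i ord0) => x y /=; lra.
Qed.

Lemma inv_nat_small (c e : R) : 0 < e ->
  exists N : nat, forall k, (N <= k)%N -> c * k.+1%:R^-1 < e.
Proof.
move=> e0; have := archi_boundP (divr_ge0 (normr_ge0 c) (ltW e0)).
set N := Num.Def.archi_bound _ => hN; exists N => k Nk.
rewrite ltr_pdivrMr ?ltr0n// mulrC -ltr_pdivrMr//.
apply: le_lt_trans (lt_le_trans hN _).
  by rewrite ler_wpM2r ?ler_norm// invr_ge0 ltW.
by rewrite ler_nat ltnW.
Qed.

End CauchyRate.

(** * Dependence of solutions on the parameter and on initial values *)

Section ParametricSystem.
Variable R : realType.
Local Notation normc := (@Normc.normc R).
Local Notation mu := (@lebesgue_measure R).
Variables (n : nat) (a b : R).
Hypothesis ab : a <= b.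
Variables (F0 E : R -> 'M[R[i]]_n) (C0 : R).
Hypothesis (C0_ge0 : 0 <= C0) (bF0 : mx_aebd a b F0 C0) (bE : mx_aebd a b E C0).
Implicit Types (s t M lam m : R) (w v : R -> 'cV[R[i]]_n).

(* The parameter enters affinely, as the eigenvalue does in Q - lam W. *)
Definition Fl lam s := F0 s - lam%:C *: E s.

Lemma Fl_bd lam (Lam M : R) s : `|lam| <= Lam ->
  (forall i j, normc (F0 s i j) <= M) -> (forall i j, normc (E s i j) <= M) ->
  forall i j, normc (Fl lam s i j) <= M * (1 + Lam).
Proof.
move=> hl h1 h2 i j; rewrite !mxE.
apply: le_trans (le_normcD _ _) _; rewrite normcN Normc.normcM normc_real.
by rewrite mulrDr mulr1 lerD ?h1// mulrC ler_pM ?normc_ge0.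
Qed.

Lemma Fl_aebd lam (Lam : R) : `|lam| <= Lam -> mx_aebd a b (Fl lam) (C0 * (1 + Lam)).
Proof.
move=> hl; apply: ae_imp2 bF0 bE => s h1 h2 sab.
exact: Fl_bd hl (h1 sab) (h2 sab).
Qed.
(** Separates a homogeneous term in w - v from a forcing term of size |lam - m| |v|, which is the
    shape of the hypothesis of [gronwall]. *)
Lemma Fl_mulB lam m s (w v : 'cV[R[i]]_n) :
  Fl lam s *m w - Fl m s *m v =
  Fl lam s *m (w - v) - (lam - m)%:C *: (E s *m v).
Proof.
have -> : Fl m s = Fl lam s + (lam - m)%:C *: E s.
  by rewrite /Fl rmorphB scalerBl addrA subrK.
move: (Fl lam s) (lam - m)%:C => A c.
by rewrite mulmxDl -scalemxAl mulmxBr opprD addrA.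
Qed.

(** [gronwall] is used twice: on v alone, to bound it by its initial value, and then on w - v, whose
    forcing term the first bound controls. [K] precedes the parameters and solutions, so it serves
    along a whole sequence. *)
Lemma lsol_stable (Lam : R) : 0 <= Lam -> exists2 K : R, 0 <= K &
  forall lam m w v, `|lam| <= Lam -> `|m| <= Lam ->
    lsol a b (Fl lam) w -> lsol a b (Fl m) v ->
    forall t, a <= t <= b ->
      vn (w t - v t) <= K * (vn (w a - v a) + `|lam - m| * vn (v a)).
Proof.
move=> Lam0; pose C := n%:R * (C0 * (1 + Lam)) + 1.
have Cg0 : 0 <= n%:R * (C0 * (1 + Lam)) by rewrite !mulr_ge0// addr_ge0.
have C_gt0 : 0 < C by rewrite ltr_wpDl.
have [K K0 hK] := gronwall n ab C_gt0.
have Flb lam s (w : 'cV[R[i]]_n) :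
    (forall i j, normc (Fl lam s i j) <= C0 * (1 + Lam)) ->
    vn (Fl lam s *m w) <= C * vn w.
  move=> h; apply: le_trans (ler_vn_mulmx _ h) _.
  by rewrite ler_wpM2r ?vn_ge0// /C lerDl.
have growth m v : `|m| <= Lam -> lsol a b (Fl m) v ->
    forall t, a <= t <= b -> vn (v t) <= K * vn (v a).
  move=> mL hv; have [B B0 hB] := lsol_bounded hv.
  have := hK v (fun s => Fl m s *m v s) (vn (v a)) 0 B (lexx 0) hv.1 hv.2 hB.
  rewrite addr0; apply => //.
  apply: ae_imp (Fl_aebd mL) => s h /h {}h; rewrite addr0; exact: Flb.
have nC0 : 0 <= n%:R * C0 by rewrite mulr_ge0.
(* The inner [K] comes from the growth of v, the outer one from the estimate of w - v with the
   forcing bound [del] below. *)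
exists (K * (1 + n%:R * C0 * K)); first by rewrite mulr_ge0// addr_ge0// mulr_ge0.
move=> lam m w v lL mL hw hv t tab.
have [B B0 hB] := lsol_bounded hw; have [B' B'0 hB'] := lsol_bounded hv.
pose G s := Fl lam s *m w s - Fl m s *m v s.
have GE s i : G s i ord0 = (Fl lam s *m w s) i ord0 - (Fl m s *m v s) i ord0.
  by rewrite /G [LHS]mxE [X in _ + X]mxE.
pose del := `|lam - m| * (n%:R * C0 * (K * vn (v a))).
have del0 : 0 <= del by rewrite !mulr_ge0// vn_ge0.
have iG i : cintg a b (fun x => G x i ord0).
  have := cintgB (hw.1 i) (hv.1 i); congr (cintg a b _); apply/funext => s.
  by rewrite GE.
have eG x : a <= x <= b -> w x - v x = w a - v a + cint_vec a x G.
  move=> /[dup] xab /andP[ax xb]; rewrite hw.2// hv.2//.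
  apply/matrixP => i j; rewrite !mxE.
  have -> : cint a x (fun s => G s i ord0) =
    cint a x (fun s => (Fl lam s *m w s) i ord0) -
    cint a x (fun s => (Fl m s *m v s) i ord0).
    rewrite -cintB; [|exact: cintgS (hw.1 i)|exact: cintgS (hv.1 i)].
    by apply: eq_cint => s _; rewrite GE.
  ring.
have := hK (fun s => w s - v s) G (vn (w a - v a)) del (B + B') del0 iG eG.
move=> /(_ _ _ (lexx _) _ tab) hh.
apply: le_trans (hh _ _) _.
- move=> x xab; apply: le_trans (ler_vnD _ _) _; rewrite vnN lerD//.
    exact: hB.
  exact: hB'.
- apply: ae_imp2 (Fl_aebd lL) bE => s h1 h2 sab.
  rewrite /G Fl_mulB; apply: le_trans (ler_vnD _ _) _; rewrite vnN vnZ.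
  apply: lerD; first exact: Flb (h1 sab).
  rewrite normc_real ler_wpM2l//.
  apply: le_trans (ler_vn_mulmx _ (h2 sab)) _; rewrite ler_wpM2l//.
  by apply: growth hv _ _ => //; move: sab; rewrite /= in_itv.
- rewrite -mulrA ler_wpM2l// /del.
  have p1 : 0 <= n%:R * C0 * K by rewrite mulr_ge0.
  have := mulr_ge0 p1 (vn_ge0 (w a - v a)).
  have := mulr_ge0 (normr_ge0 (lam - m)) (vn_ge0 (v a)).
  lra.
Qed.

(* Measurability of Fl lam *m w is inherited from the sequence as a pointwise
   limit, so the coefficients themselves need not be measurable. *)
Lemma lsol_limit (Lam : R) lam (lam_ : nat -> R) (w_ : nat -> R -> 'cV[R[i]]_n)
    (x : 'cV[R[i]]_n) :
  `|lam| <= Lam -> (forall k, `|lam_ k| <= Lam) ->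
  (forall k, `|lam_ k - lam| <= k.+1%:R^-1) ->
  (forall k, vn (w_ k a - x) <= k.+1%:R^-1) ->
  (forall k, lsol a b (Fl (lam_ k)) (w_ k)) ->
  exists w K, [/\ lsol a b (Fl lam) w, w a = x &
    forall k t, a <= t <= b -> vn (w_ k t - w t) <= K * k.+1%:R^-1].
Proof.
move=> lL lkL lk xk hk.
have Lam0 : 0 <= Lam by exact: le_trans lL.
have [K K0 hK] := lsol_stable Lam0.
pose X := vn x + 1.
have X0 : 0 <= X by rewrite addr_ge0// vn_ge0.
have k1 k : (k.+1%:R^-1 : R) <= 1.
  by rewrite invf_le1 ?ltr0n// ler1n.
have k0 k : 0 <= (k.+1%:R^-1 : R) by rewrite invr_ge0.
have wX k : vn (w_ k a) <= X.
  rewrite -(subrK x (w_ k a)) (le_trans (ler_vnD _ _))// addrC lerD2l.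
  by rewrite (le_trans (xk k)).
have cau t : a <= t <= b -> forall k l, vn (w_ k t - w_ l t) <=
    (K * (1 + X)) * (k.+1%:R^-1 + l.+1%:R^-1).
  move=> tab k l; apply: le_trans (hK _ _ _ _ (lkL k) (lkL l) (hk k) (hk l) _ tab) _.
  rewrite -mulrA ler_wpM2l// mulrDl mul1r; apply: lerD.
    apply: le_trans (ler_vn_dist _ x _) _; rewrite lerD// vn_distC; exact: xk.
  rewrite mulrC ler_pM ?vn_ge0//.
  apply: le_trans (ler_distD lam _ _) _; rewrite lerD// distrC; exact: lk.
pose c := n%:R * (2 * (K * (1 + X))).
have c0 : 0 <= c by rewrite !mulr_ge0// addr_ge0.
(* The limit is picked separately at each [t], but with one constant [c]; that uniformity lets the
   integral equation pass to the limit. *)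
have /choice[w hw] : forall t, exists z, a <= t <= b ->
    forall k, vn (w_ k t - z) <= c * k.+1%:R^-1.
  move=> t; have [tab|] := boolP (a <= t <= b); last by exists 0.
  by have [z hz] := vec_cauchy_rate (cau t tab); exists z => _.
have wa : w a = x.
  apply/eqP; rewrite -subr_eq0; apply/eqP; apply: vn_le0.
  apply: (@le0_of_le_inv _ _ (c + 1)) => k.
  apply: le_trans (ler_vn_dist _ (w_ k a) _) _; rewrite mulrDl mul1r lerD//.
  by rewrite vn_distC; apply: hw; rewrite lexx ab.
have [B1 B10 hB1] := lsol_bounded (hk 0%N).
pose B := c + B1; have B0 : 0 <= B by rewrite addr_ge0.
have wB t : a <= t <= b -> vn (w t) <= B.
  move=> tab; rewrite -(subrK (w_ 0%N t) (w t)) (le_trans (ler_vnD _ _))//.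
  rewrite lerD ?hB1// vn_distC.
  by have := hw t tab 0%N; rewrite invr1 mulr1.
(* The coefficient bound [M] stays free. For the integrals, M = C0 works almost everywhere;
   measurability asks for convergence at every s, and there [M] is a finite bound depending on s. *)
pose cM M := n%:R * M * ((1 + Lam) * c + B).
have Dpt M s k : 0 <= M -> a <= s <= b ->
    (forall i j, normc (F0 s i j) <= M) -> (forall i j, normc (E s i j) <= M) ->
    vn (Fl (lam_ k) s *m w_ k s - Fl lam s *m w s) <= cM M * k.+1%:R^-1.
  move=> M0 sab h1 h2; rewrite Fl_mulB.
  apply: le_trans (ler_vnD _ _) _; rewrite vnN vnZ normc_real.
  have -> : cM M * k.+1%:R^-1 = n%:R * (M * (1 + Lam)) * (c * k.+1%:R^-1) +
      k.+1%:R^-1 * (n%:R * M * B) by rewrite /cM; ring.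
  apply: lerD.
    apply: le_trans (ler_vn_mulmx _ (Fl_bd (lkL k) h1 h2)) _.
    by rewrite ler_wpM2l ?hw// !mulr_ge0// addr_ge0.
  apply: ler_pM => //; first exact: vn_ge0.
  apply: le_trans (ler_vn_mulmx _ h2) _.
  by rewrite ler_wpM2l ?wB// !mulr_ge0.
have cM0 M : 0 <= M -> 0 <= cM M.
  by move=> M0; rewrite /cM !mulr_ge0// addr_ge0// mulr_ge0// addr_ge0.
have bD k : {ae mu, forall s, `[a, b]%classic s ->
    vn (Fl (lam_ k) s *m w_ k s - Fl lam s *m w s) <= cM C0 * k.+1%:R^-1}.
  apply: ae_imp2 bF0 bE => s h1 h2 sab.
  exact: Dpt (h1 sab) (h2 sab).
have mw i : cmeas a b (fun s => (Fl lam s *m w s) i ord0).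
  apply: (@cmeas_lim _ _ _ (fun k s => (Fl (lam_ k) s *m w_ k s) i ord0)).
    by move=> k; apply: cintg_meas; exact: (hk k).1.
  move=> s sab e e0.
  have {}sab : a <= s <= b by move: sab; rewrite /= in_itv.
  pose M := \sum_i \sum_j (normc (F0 s i j) + normc (E s i j)).
  have hM i' j' : normc (F0 s i' j') + normc (E s i' j') <= M.
    rewrite /M (bigD1 i')//= (bigD1 j')//= -addrA lerDl addr_ge0//.
      by apply: sumr_ge0 => j _; rewrite addr_ge0 ?normc_ge0.
    apply: sumr_ge0 => j _; apply: sumr_ge0 => l _.
    by rewrite addr_ge0 ?normc_ge0.
  have M0 : 0 <= M.
    apply: sumr_ge0 => j _; apply: sumr_ge0 => l _.
    by rewrite addr_ge0 ?normc_ge0.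
  have [N hN] := inv_nat_small (cM M) e0.
  exists N => k /hN; apply: le_lt_trans.
  apply: le_trans (@Dpt M s k M0 sab _ _).
  - have := ler_normc_vn (Fl (lam_ k) s *m w_ k s - Fl lam s *m w s) i.
    by rewrite [X in normc X]mxE [X in normc (_ + X)]mxE.
  - by move=> i' j'; apply: le_trans (hM i' j'); rewrite lerDl normc_ge0.
  - by move=> i' j'; apply: le_trans (hM i' j'); rewrite lerDr normc_ge0.
have iw i : cintg a b (fun s => (Fl lam s *m w s) i ord0).
  apply: (@cmeas_ae_bd_cintg _ _ _ (n%:R * (C0 * (1 + Lam)) * B)) => //.
  apply: ae_imp (Fl_aebd lL) => s h sab.
  apply: le_trans (ler_normc_vn _ _) _.
  apply: le_trans (ler_vn_mulmx _ (h sab)) _.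
  rewrite ler_wpM2l ?wB//.
  by rewrite !mulr_ge0// addr_ge0.
exists w, c; split => //; last by move=> k t tab; exact: hw.
split => // t /[dup] tab /andP[at_ tb].
apply/eqP; rewrite -subr_eq0; apply/eqP; apply: vn_le0.
pose I k := cint_vec a t (fun s => Fl (lam_ k) s *m w_ k s - Fl lam s *m w s).
(* Three errors: w - w_k at [t], the initial values, and the difference of the integrals. *)
apply: (@le0_of_le_inv _ _ (c + 1 + n%:R * (2 * cM C0 * (t - a)))) => k.
have -> : w t - (w a + cint_vec a t (fun s => Fl lam s *m w s)) =
    (w t - w_ k t) + ((w_ k a - w a) + I k).
  rewrite {1}((hk k).2 t tab).
  apply/matrixP => i j; rewrite !mxE.
  have -> : cint a t (fun s => (Fl (lam_ k) s *m w_ k s - Fl lam s *m w s) i ord0)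
    = cint a t (fun s => (Fl (lam_ k) s *m w_ k s) i ord0) -
      cint a t (fun s => (Fl lam s *m w s) i ord0).
    rewrite -cintB; [|exact: cintgS ((hk k).1 i)|exact: cintgS (iw i)].
    by apply: eq_cint => s _; rewrite [LHS]mxE [X in _ + X]mxE.
  ring.
set T := n%:R * _.
have -> : (c + 1 + T) / k.+1%:R = c / k.+1%:R + (k.+1%:R^-1 + T / k.+1%:R) by ring.
apply: le_trans (ler_vnD _ _) _; apply: lerD; first by rewrite vn_distC hw.
apply: le_trans (ler_vnD _ _) _; apply: lerD; first by rewrite wa.
apply: (@le_trans _ _ (n%:R * (2 * (cM C0 * k.+1%:R^-1) * (t - a)))); last first.
  by rewrite le_eqVlt; apply/orP; left; apply/eqP; rewrite /T; ring.
apply: ler_vn_cint => //; first by rewrite mulr_ge0// cM0.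
  move=> i; have := cintgB (cintgS (lexx a) tb ((hk k).1 i)) (cintgS (lexx a) tb (iw i)).
  by congr (cintg a t _); apply/funext => s; rewrite [RHS]mxE [X in _ = _ + X]mxE.
apply: ae_imp (bD k) => s h; rewrite /= in_itv /= => /andP[as_ st].
by apply: h; rewrite /= in_itv /= as_ (le_trans st).
Qed.

End ParametricSystem.

(** * Bounds for the inverse of a coercive real matrix *)

Section CoerciveMatrix.
Variables (R : realType) (d : nat) (mu1 : R) (P : 'M[R]_d).
Hypothesis mu1_gt0 : 0 < mu1.
Hypothesis Pge : forall v : 'cV[R]_d,
  mu1 * (v^T *m v) ord0 ord0 <= (v^T *m P *m v) ord0 ord0.

Lemma sqnormE (v : 'cV[R]_d) : (v^T *m v) ord0 ord0 = \sum_i v i ord0 ^+ 2.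
Proof. by rewrite mxE; apply: eq_bigr => i _; rewrite mxE expr2. Qed.

Lemma sqr_le_sqnorm (v : 'cV[R]_d) i : v i ord0 ^+ 2 <= (v^T *m v) ord0 ord0.
Proof.
rewrite sqnormE (bigD1 i)//= lerDl; apply: sumr_ge0 => j _; exact: sqr_ge0.
Qed.

(** A row r with r P^T = 0 makes the quadratic form of [P] vanish at r^T, and coercivity then forces
    r = 0. *)
Lemma coercive_unitmx : P \in unitmx.
Proof.
rewrite -unitmx_tr -row_free_unit -kermx_eq0; apply/eqP/row_matrixP => i.
rewrite row0; set r := row i _.
have rP : r *m P^T = 0.
  by apply/sub_kermxP; exact: row_sub.
have := Pge r^T; rewrite trmxK.
have -> : r *m P *m r^T = r *m (r *m P^T)^T by rewrite trmx_mul trmxK mulmxA.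
rewrite rP trmx0 mulmx0 [leRHS]mxE => h.
apply/matrixP => i' j; rewrite ord1 [RHS]mxE; apply/eqP.
rewrite -sqrf_eq0 eq_le sqr_ge0 andbT.
have := sqr_le_sqnorm r^T j; rewrite trmxK mxE => /le_trans; apply.
by rewrite -(pmulr_rle0 _ mu1_gt0).
Qed.

(** The j-th column w of the inverse satisfies w^T P w = w_j, so mu1 w_k^2 <= w_j for all k. Taking
    k = j gives w_j <= 1 / mu1, and then k = i gives the claim. *)
Lemma coercive_inv_bd i j : `|invmx P i j| <= mu1^-1.
Proof.
pose w := col j (invmx P).
have Pw : P *m w = delta_mx j (ord0 : 'I_1).
  by rewrite /w colE mulmxA mulmxV ?coercive_unitmx// mul1mx.
have := Pge w; rewrite -mulmxA Pw.
have -> : (w^T *m delta_mx j (ord0 : 'I_1)) ord0 ord0 = w j ord0.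
  by rewrite -colE !mxE.
have wi k : w k ord0 = invmx P k j by rewrite mxE.
move=> h.
have hk k : mu1 * w k ord0 ^+ 2 <= w j ord0.
  by apply: le_trans h; rewrite ler_pM2l// sqr_le_sqnorm.
have wj0 : 0 <= w j ord0.
  by apply: le_trans (hk j); rewrite mulr_ge0 ?sqr_ge0// ltW.
have wj : w j ord0 <= mu1^-1.
  rewrite -[leRHS]mul1r ler_pdivlMr// mulrC.
  have [->|wn] := eqVneq (w j ord0) 0; first by rewrite mulr0.
  have wp : 0 < w j ord0 by rewrite lt_neqAle eq_sym wn.
  by rewrite -(ler_pM2r wp) mul1r -mulrA -expr2.
rewrite -wi -(@ler_pXn2r _ 2)// ?nnegrE ?invr_ge0 ?(ltW mu1_gt0)//.
rewrite real_normK ?num_real// -(ler_pM2l mu1_gt0) (le_trans (hk i))//.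
by rewrite expr2 mulrA divff ?gt_eqF// mul1r.
Qed.

(** With w = P^{-1} v the form equals w^T P w >= mu1 |w|^2, and v = P w gives |v_k| <= M sum |w_i|.
    The bound depends on [P] only through [mu1] and [M], so it is uniform in time. *)
Lemma coercive_inv_ge (M : R) (v : 'cV[R]_d) k : 0 < M -> (0 < d)%N ->
  (forall i j, `|P i j| <= M) ->
  mu1 * ((`|v k ord0| / M) ^+ 2 / d%:R) <= (v^T *m invmx P *m v) ord0 ord0.
Proof.
move=> M0 d0 PM; pose w := invmx P *m v.
have vE : v = P *m w by rewrite /w mulmxA mulmxV ?coercive_unitmx// mul1mx.
have -> : (v^T *m invmx P *m v) ord0 ord0 = (w^T *m P *m w) ord0 ord0.
  rewrite -[in RHS]mulmxA -vE -mulmxA -/w !mxE.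
  by apply: eq_bigr => i _; rewrite !mxE mulrC.
apply: le_trans (Pge w); rewrite ler_pM2l// sqnormE.
set S := _ / M.
have dR : 0 < d%:R :> R by rewrite ltr0n.
(* Instead of Cauchy-Schwarz: x^2 >= 2 tau x - tau^2, with tau optimal. *)
pose tau := S / d%:R.
have hS : S <= \sum_i `|w i ord0|.
  rewrite /S ler_pdivrMr// {1}vE mxE (le_trans (ler_norm_sum _ _ _))//.
  rewrite mulr_suml; apply: ler_sum => j _; rewrite normrM mulrC.
  by rewrite ler_wpM2l.
have S0 : 0 <= S by rewrite divr_ge0// ltW.
have tau0 : 0 <= tau by rewrite divr_ge0.
have h i : 2 * tau * `|w i ord0| - tau ^+ 2 <= w i ord0 ^+ 2.
  rewrite -[leRHS]real_normK ?num_real//.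
  by have := sqr_ge0 (`|w i ord0| - tau); rewrite sqrrB; lra.
apply: le_trans (ler_sum _ (fun i _ => h i)).
rewrite sumrB sumr_const card_ord -mulr_sumr -[tau ^+ 2 *+ d]mulr_natl.
have -> : S ^+ 2 / d%:R = 2 * tau * S - d%:R * tau ^+ 2.
  by rewrite /tau; field; exact: lt0r_neq0.
by rewrite lerD2r ler_wpM2l// mulr_ge0.
Qed.

End CoerciveMatrix.

(** * Real matrices acting on complex vectors *)

Section ComplexifiedMatrices.
Variable R : realType.
Local Notation normc := (@Normc.normc R).

Lemma cmxB m n (A B : 'M[R]_(m, n)) : cmx (A - B) = cmx A - cmx B.
Proof. by apply/matrixP => i j; rewrite !mxE rmorphB. Qed.

Lemma cmxZ m n (c : R) (A : 'M[R]_(m, n)) : cmx (c *: A) = c%:C *: cmx A.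
Proof. by apply/matrixP => i j; rewrite !mxE rmorphM. Qed.

Lemma adjmx_cmx m n (A : 'M[R]_(m, n)) : adjmx (cmx A) = cmx A^T.
Proof. by apply/matrixP => i j; rewrite !mxE /= oppr0. Qed.

Lemma dotE n (u v : 'cV[R[i]]_n) :
  (adjmx u *m v) ord0 ord0 = \sum_i (u i ord0)^*%C * v i ord0.
Proof. by rewrite mxE; apply: eq_bigr => i _; rewrite !mxE. Qed.

Lemma dot_col_mx m n (u u' : 'cV[R[i]]_m) (v v' : 'cV[R[i]]_n) :
  (adjmx (col_mx u v) *m col_mx u' v') ord0 ord0 =
  (adjmx u *m u') ord0 ord0 + (adjmx v *m v') ord0 ord0.
Proof.
rewrite !dotE big_split_ord /=; congr (_ + _); apply: eq_bigr => i _.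
  by rewrite !col_mxEu.
by rewrite !col_mxEd.
Qed.

End ComplexifiedMatrices.

(** * The boundary condition in the chart of K *)

Section BoundaryCondition.
Variables (R : realType) (d : nat) (K : {set 'I_(d + d)}).
Local Notation C := R[i].
Implicit Types rho eta : 'cV[C]_(d + d).

(* With rho = (-y(a), y(b)) and eta = (z(a), z(b)) the boundary condition reads
   S u + v = 0, see bc_of_mul. *)
Definition ucomb rho eta : 'cV[C]_(d + d) :=
  \col_i (if i \in K then eta i ord0 else rho i ord0).
Definition vcomb rho eta : 'cV[C]_(d + d) :=
  \col_i (if i \in K then - rho i ord0 else eta i ord0).

Lemma bc_of_mul S rho eta :
  bc_of K S *m col_mx rho eta = S *m ucomb rho eta + vcomb rho eta.
Proof.
rewrite mul_row_col; apply/matrixP => j k; rewrite ord1 !mxE.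
rewrite -big_split /=.
have -> : (if j \in K then - rho j ord0 else eta j ord0) =
    \sum_i (j == i)%:R * vcomb rho eta i ord0.
  rewrite (bigD1 j)//= eqxx mul1r mxE big1 ?addr0// => i ij.
  by rewrite eq_sym (negbTE ij) mul0r.
rewrite -big_split /=; apply: eq_bigr => i _; rewrite !mxE.
case: ifP => _; first by rewrite mulNr mulrN addrC.
by [].
Qed.

(** Replacing (rho_i, eta_i) by (eta_i, - rho_i) for i in K is a symplectic change of coordinates,
    so the boundary form looks the same in every chart. *)
Lemma symplectic_comb rho eta rho' eta' :
  (adjmx (ucomb rho eta) *m vcomb rho' eta') ord0 ord0 -
  (adjmx (vcomb rho eta) *m ucomb rho' eta') ord0 ord0 =
  (adjmx rho *m eta') ord0 ord0 - (adjmx eta *m rho') ord0 ord0.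
Proof.
rewrite !dotE -!sumrB; apply: eq_bigr => i _; rewrite !mxE.
case: ifP => _ //.
by rewrite rmorphN; ring.
Qed.

Lemma ucombB rho eta rho' eta' :
  ucomb rho eta - ucomb rho' eta' = ucomb (rho - rho') (eta - eta').
Proof. by apply/matrixP => i j; rewrite !mxE; case: ifP. Qed.

Lemma vcombB rho eta rho' eta' :
  vcomb rho eta - vcomb rho' eta' = vcomb (rho - rho') (eta - eta').
Proof.
by apply/matrixP => i j; rewrite !mxE; case: ifP; rewrite // opprD opprK.
Qed.

Lemma ler_vn_ucomb rho eta : vn (ucomb rho eta) <= vn rho + vn eta.
Proof.
rewrite /vn -big_split /=; apply: ler_sum => i _; rewrite mxE.
by case: ifP => _; rewrite ?lerDl ?lerDr normc_ge0.
Qed.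

Lemma ler_vn_vcomb rho eta : vn (vcomb rho eta) <= vn rho + vn eta.
Proof.
rewrite /vn -big_split /=; apply: ler_sum => i _; rewrite mxE.
by case: ifP => _; rewrite ?normcN ?lerDl ?lerDr normc_ge0.
Qed.

End BoundaryCondition.

(** * The Sturm-Liouville equation as a first-order system; Lagrange identity *)

Section SturmLiouvilleSystem.
Variables (R : realType) (d : nat) (a b : R) (P Q W : R -> 'M[R]_d).
Hypothesis ab : a < b.
Hypothesis Om : in_Omega a b P Q W.
Local Notation normc := (@Normc.normc R).
Local Notation mu := (@lebesgue_measure R).
Local Notation C := R[i].
Implicit Types (y z : R -> 'cV[C]_d) (lam : R).

(* The pair (y, z) solves (y, z)' = (SL0 - lam SL1) (y, z). *)
Definition SL0 (s : R) : 'M[C]_(d + d) :=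
  block_mx 0 (cmx (invmx (P s))) (cmx (Q s)) 0.
Definition SL1 (s : R) : 'M[C]_(d + d) := block_mx 0 0 (cmx (W s)) 0.
Local Notation SL lam := (Fl SL0 SL1 lam).
Local Notation stk y z := (fun t => col_mx (y t) (z t)).

Lemma SL_mul lam s (u v : 'cV[C]_d) : SL lam s *m col_mx u v =
  col_mx (cmx (invmx (P s)) *m v) (cmx (Q s - lam *: W s) *m u).
Proof.
rewrite /Fl /SL0 /SL1 scale_block_mx opp_block_mx add_block_mx mul_block_col.
rewrite !scaler0 !oppr0 !addr0 !mul0mx add0r addr0.
by rewrite -cmxZ -cmxB.
Qed.

Lemma Linf_bd (F : R -> 'M[R]_d) : Linf_mx a b F -> exists2 M : R, 0 < M &
  {ae mu, forall t, `[a, b]%classic t -> forall i j, `|F t i j| <= M}.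
Proof.
move=> [_ [M h]]; exists (`|M| + 1); first by rewrite ltr_wpDl.
apply: ae_imp h => t h tab i j.
by rewrite (le_trans (h tab i j))// (le_trans (ler_norm M))// lerDl.
Qed.

Lemma SL_aebd : exists2 C0 : R, 0 <= C0 & mx_aebd a b SL0 C0 /\ mx_aebd a b SL1 C0.
Proof.
have [_ /Linf_bd[MQ MQ0 hQ] /Linf_bd[MW MW0 hW] _ [mu1 [mu2 [mu10 _ hP _]]]] := Om.
have m0 : 0 <= mu1^-1 by rewrite invr_ge0 ltW.
exists (mu1^-1 + MQ + MW); first by rewrite !addr_ge0// ltW.
split.
  apply: ae_imp2 hP hQ => s h1 h2 sab i j; rewrite /SL0.
  have c0 : 0 <= mu1^-1 + MQ + MW by rewrite !addr_ge0// ltW.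
  case: (split_ordP i) => k ->; case: (split_ordP j) => l ->.
  - by rewrite block_mxEul mxE Normc.normc0.
  - rewrite block_mxEur mxE normc_real (le_trans (coercive_inv_bd mu10 (h1 sab) _ _))//.
    by rewrite -addrA lerDl addr_ge0// ltW.
  - rewrite block_mxEdl mxE normc_real (le_trans (h2 sab _ _))//.
    by rewrite addrAC lerDr addr_ge0// ltW.
  - by rewrite block_mxEdr mxE Normc.normc0.
apply: ae_imp hW => s h1 sab i j; rewrite /SL1.
have c0 : 0 <= mu1^-1 + MQ + MW by rewrite !addr_ge0// ltW.
case: (split_ordP i) => k ->; case: (split_ordP j) => l ->.
- by rewrite block_mxEul mxE Normc.normc0.
- by rewrite block_mxEur mxE Normc.normc0.
- rewrite block_mxEdl mxE normc_real (le_trans (h1 sab _ _))//.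
  by rewrite lerDr addr_ge0// ltW.
- by rewrite block_mxEdr mxE Normc.normc0.
Qed.

Lemma is_solutionE AB lam y z : is_solution a b P Q W AB lam y z <->
  lsol a b (SL lam) (stk y z) /\ AB *m bvals a b y z = 0.
Proof.
have eu s i : (SL lam s *m col_mx (y s) (z s)) (lshift d i) ord0 =
    (cmx (invmx (P s)) *m z s) i ord0 by rewrite SL_mul col_mxEu.
have ed s i : (SL lam s *m col_mx (y s) (z s)) (rshift d i) ord0 =
    (cmx (Q s - lam *: W s) *m y s) i ord0 by rewrite SL_mul col_mxEd.
have ec t : cint_vec a t (fun s => SL lam s *m col_mx (y s) (z s)) =
    col_mx (cint_vec a t (fun s => cmx (invmx (P s)) *m z s))
           (cint_vec a t (fun s => cmx (Q s - lam *: W s) *m y s)).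
  apply/matrixP => i j; rewrite ord1 mxE.
  case: (split_ordP i) => k ->; rewrite ?col_mxEu ?col_mxEd mxE.
    by apply: eq_cint => s _; rewrite eu.
  by apply: eq_cint => s _; rewrite ed.
split.
  move=> [i1 i2 e bc]; split => //; split.
    move=> i; case: (split_ordP i) => k ->.
      by under eq_fun do rewrite eu; exact: i1.
    by under eq_fun do rewrite ed; exact: i2.
  move=> t tab; have [|-> ->] := e t; first by rewrite /Iab /= in_itv.
  by rewrite ec add_col_mx.
move=> [[i e] bc]; split => //.
- move=> k; have := i (lshift d k); under eq_fun do rewrite eu; exact.
- move=> k; have := i (rshift d k); under eq_fun do rewrite ed; exact.
- move=> t; rewrite /Iab /= in_itv /= => /e; rewrite ec add_col_mx.
  by move=> /eq_col_mx[].
Qed.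

(** Prepares the entries of y and z for [prod_rule], with one essential bound for all
    derivatives. *)
Lemma lsol_components lam y z : lsol a b (SL lam) (stk y z) ->
  exists2 M : R, 0 <= M & forall i,
  [/\ prim a b (fun t => y t i ord0) (fun s => (cmx (invmx (P s)) *m z s) i ord0),
      ae_bd a b (fun s => (cmx (invmx (P s)) *m z s) i ord0) M,
      prim a b (fun t => z t i ord0)
        (fun s => (cmx (Q s - lam *: W s) *m y s) i ord0) &
      ae_bd a b (fun s => (cmx (Q s - lam *: W s) *m y s) i ord0) M].
Proof.
move=> h; have [C0 C00 [b0 b1]] := SL_aebd.
have bS := Fl_aebd b0 b1 (lexx `|lam|).
have [B B0 hB] := lsol_deriv_aebd bS h (mulr_ge0 C00 (addr_ge0 ler01 (normr_ge0 _))).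
have eu i : (fun s => (SL lam s *m col_mx (y s) (z s)) (lshift d i) ord0) =
    (fun s => (cmx (invmx (P s)) *m z s) i ord0).
  by apply/funext => s; rewrite SL_mul col_mxEu.
have ed i : (fun s => (SL lam s *m col_mx (y s) (z s)) (rshift d i) ord0) =
    (fun s => (cmx (Q s - lam *: W s) *m y s) i ord0).
  by apply/funext => s; rewrite SL_mul col_mxEd.
exists B => // i; split.
- have := lsol_prim (lshift d i) h; rewrite eu.
  by under eq_fun do rewrite col_mxEu.
- by rewrite -eu.
- have := lsol_prim (rshift d i) h; rewrite ed.
  by under eq_fun do rewrite col_mxEd.
- by rewrite -ed.
Qed.

Lemma ae_bdW (f : R -> C) (M M' : R) : M <= M' -> ae_bd a b f M -> ae_bd a b f M'.
Proof. by move=> h; apply: ae_imp => x k /k /le_trans; exact. Qed.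

Lemma ae_bd_conj (f : R -> C) (M : R) : ae_bd a b f M ->
  ae_bd a b (fun s => (f s)^*%C) M.
Proof. by apply: ae_imp => x k /k; rewrite normc_conj. Qed.

Definition rhov y : 'cV[C]_(d + d) := col_mx (- y a) (y b).
Definition etav z : 'cV[C]_(d + d) := col_mx (z a) (z b).

Lemma Wform_meas lam lam' y z y' z' : lsol a b (SL lam) (stk y z) ->
  lsol a b (SL lam') (stk y' z') ->
  cmeas a b (fun s => (adjmx (y s) *m cmx (W s) *m y' s) ord0 ord0).
Proof.
move=> /lsol_components[M M0 h] /lsol_components[M' M'0 h'].
have abW := ltW ab.
have my i : cmeas a b (fun t => y t i ord0).
  by have [p1 p2 _ _] := h i; exact: prim_meas p2.
have my' i : cmeas a b (fun t => y' t i ord0).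
  by have [p1 p2 _ _] := h' i; exact: prim_meas p2.
have mW i j : cmeas a b (fun t => (W t i j)%:C).
  by have [_ _ [mW _] _ _] := Om; split => //=; exact: mW.
rewrite (_ : (fun s => _) = (fun s => \sum_j
    ((\sum_i ((y s i ord0)^*%C * (W s i j)%:C)) * y' s j ord0))).
  apply: cmeas_sum => j; apply: cmeasM => //; apply: cmeas_sum => i.
  by apply: cmeasM => //; exact: cmeas_conj.
apply/funext => s; rewrite mxE; apply: eq_bigr => j _; rewrite mxE.
by congr (_ * _); apply: eq_bigr => i _; rewrite !mxE.
Qed.

Lemma Wform_aebd y y' : exists2 c : R, 0 <= c &
  {ae mu, forall s, `[a, b]%classic s ->
    normc ((adjmx (y s) *m cmx (W s) *m y' s) ord0 ord0) <=
    c * (vn (y s) * vn (y' s))}.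
Proof.
have [_ _ /Linf_bd[MW MW0 hW] _ _] := Om.
exists (d%:R * MW); first by rewrite mulr_ge0// ltW.
apply: ae_imp hW => s h sab; rewrite -mulmxA.
have -> : d%:R * MW * (vn (y s) * vn (y' s)) = vn (y s) * (d%:R * MW * vn (y' s)).
  by ring.
apply: (@le_trans _ _ (vn (y s) * vn (cmx (W s) *m y' s))).
  by apply: ler_normc_dot => j; rewrite !mxE normc_conj ler_normc_vn.
rewrite ler_wpM2l ?vn_ge0//; apply: ler_vn_mulmx => i j.
by rewrite mxE normc_real h.
Qed.

(** The minus sign in [rhov] makes the left-hand side the increment of y^* z' - z^* y' over [a, b].
    By the product rule it is an integral in which the symmetric terms P^{-1} and Q cancel, leaving
    (lam - lam') y^* W y'. *)
Lemma lagrange_identity lam lam' y z y' z' : lsol a b (SL lam) (stk y z) ->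
  lsol a b (SL lam') (stk y' z') ->
  (adjmx (rhov y) *m etav z') ord0 ord0 - (adjmx (etav z) *m rhov y') ord0 ord0 =
  - (lam' - lam)%:C *
    cint a b (fun s => (adjmx (y s) *m cmx (W s) *m y' s) ord0 ord0).
Proof.
move=> hw hw'.
have mWf := Wform_meas hw hw'.
have [M M0 h] := lsol_components hw; have [M' M'0 h'] := lsol_components hw'.
have abW := ltW ab.
pose A s := cmx (invmx (P s)); pose B l s := cmx (Q s - l *: W s).
pose h1 i s := ((A s *m z s) i ord0)^*%C * z' s i ord0 +
  (y s i ord0)^*%C * (B lam' s *m y' s) i ord0.
pose h2 i s := ((B lam s *m y s) i ord0)^*%C * y' s i ord0 +
  (z s i ord0)^*%C * (A s *m z' s) i ord0.
have N0 : 0 <= M + M' by rewrite addr_ge0.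
have MN : M <= M + M' by rewrite lerDl.
have MN' : M' <= M + M' by rewrite lerDr.
have H1 i : cintg a b (h1 i) /\ (y b i ord0)^*%C * z' b i ord0 -
    (y a i ord0)^*%C * z' a i ord0 = cint a b (h1 i).
  have [p1 p2 p3 p4] := h i; have [q1 q2 q3 q4] := h' i.
  apply: (prod_rule abW N0 (prim_conj p1) q3); last exact: ae_bdW q4.
  by apply: ae_bd_conj; exact: ae_bdW p2.
have H2 i : cintg a b (h2 i) /\ (z b i ord0)^*%C * y' b i ord0 -
    (z a i ord0)^*%C * y' a i ord0 = cint a b (h2 i).
  have [p1 p2 p3 p4] := h i; have [q1 q2 q3 q4] := h' i.
  apply: (prod_rule abW N0 (prim_conj p3) q1); last exact: ae_bdW q2.
  by apply: ae_bd_conj; exact: ae_bdW p4.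
have -> : (adjmx (rhov y) *m etav z') ord0 ord0 -
    (adjmx (etav z) *m rhov y') ord0 ord0 =
    \sum_i cint a b (h1 i) - \sum_i cint a b (h2 i).
  rewrite /rhov /etav !dot_col_mx adjmxN mulNmx mulmxN.
  have mN (X : 'M[C]_1) : (- X) ord0 ord0 = - X ord0 ord0 by rewrite mxE.
  rewrite !mN !dotE.
  rewrite [X in _ = X - _](eq_bigr _ (fun i _ => esym (H1 i).2)).
  rewrite [X in _ = _ - X](eq_bigr _ (fun i _ => esym (H2 i).2)).
  by rewrite !sumrB; ring.
have i1 := cintg_sum (index_enum 'I_d) (fun i => (H1 i).1).
have i2 := cintg_sum (index_enum 'I_d) (fun i => (H2 i).1).
rewrite -!cint_sum; [|by move=> i; have [] := H2 i|by move=> i; have [] := H1 i].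
rewrite -cintB//.
have iW : cintg a b (fun s => (adjmx (y s) *m cmx (W s) *m y' s) ord0 ord0).
  have [c c0 hc] := Wform_aebd y y'.
  have [Y Y0 hY] := lsol_bounded hw; have [Y' Y'0 hY'] := lsol_bounded hw'.
  apply: (@cmeas_ae_bd_cintg _ _ _ (c * (Y * Y'))) => //.
  apply: ae_imp hc => s hs sab; apply: le_trans (hs sab) _.
  rewrite ler_wpM2l// ler_pM ?vn_ge0//.
    by apply: le_trans (hY _ sab); rewrite vn_col_mx lerDl vn_ge0.
  by apply: le_trans (hY' _ sab); rewrite vn_col_mx lerDl vn_ge0.
(* The integrands are compared only almost everywhere, since symmetry of P, Q, W holds only
   there. *)
rewrite -cintZ//; apply: cint_ae_eq.
- exact: cintg_meas (cintgB i1 i2).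
- exact: cintg_meas (cintgZ _ iW).
have [_ _ _ [sP sQ sW] _] := Om.
have sPQ : {ae mu, forall t, `[a, b]%classic t -> (P t)^T = P t /\ (Q t)^T = Q t}.
  by apply: ae_imp2 sP sQ => s k1 k2 sab; split; [exact: k1|exact: k2].
apply: ae_imp2 sPQ sW => s hPQ hW sab /=; have [hP hQ] := hPQ sab.
have aA : adjmx (A s) = A s by rewrite /A adjmx_cmx trmx_inv hP.
have aB l : adjmx (B l s) = B l s.
  by rewrite /B adjmx_cmx linearB linearZ /= hQ// hW.
rewrite !big_split /= -!dotE !adjmxM aA aB -!mulmxA.
have -> : B lam s = B lam' s + (lam' - lam)%:C *: cmx (W s).
  rewrite /B -cmxZ !cmxB !cmxZ rmorphB scalerBl; apply/matrixP => i j.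
  by rewrite !mxE; ring.
rewrite mulmxDl mulmxDr -scalemxAl -scalemxAr.
move: (adjmx (y s) *m _) => X1; move: (adjmx (z s) *m _) => X2.
move: (adjmx (y s) *m _) => X3; rewrite !mxE; ring.
Qed.

End SturmLiouvilleSystem.

(** * Cluster points of bounded complex vectors *)

Section Compactness.
Variable R : realType.

(** Real and imaginary parts are laid side by side in a real vector of length 2 n, which lies in a
    compact box. *)
Lemma vec_cluster n (x : nat -> 'cV[R[i]]_n) (B : R) : (forall k, vn (x k) <= B) ->
  exists p : 'cV[R[i]]_n, forall (e : R) (N : nat), 0 < e ->
    exists2 k, (N <= k)%N & vn (x k - p) <= e.
Proof.
move=> xB.
pose g k : 'rV[R]_(n + n) := row_mx (\row_i complex.Re (x k i ord0))
                                    (\row_i complex.Im (x k i ord0)).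
have gB k i : g k ord0 i \in `[- B, B].
  rewrite in_itv /= -ler_norml; apply: le_trans (xB k).
  case: (split_ordP i) => j ->; rewrite /g ?row_mxEl ?row_mxEr mxE.
    by apply: le_trans (ler_Re_normc _) _; exact: ler_normc_vn.
  by apply: le_trans (ler_Im_normc _) _; exact: ler_normc_vn.
have cA : compact [set v : 'rV[R]_(n + n) | forall i, v ord0 i \in `[- B, B]].
  apply: (@rV_compact _ _ (fun=> `[- B, B]%classic)) => _.
  exact: segment_compact.
have [] := cA (g @ \oo) _.
  by exists 0%N => // k _ /= i; exact: gB.
move=> p [_ cl].
exists (\col_i Complex (p ord0 (lshift n i)) (p ord0 (rshift n i))) => e N e0.
(* Each of the n entries costs 2 e'; the added 1 avoids a zero divisor for n = 0. *)
pose e' := e / (2 * n%:R + 1).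
have n0 : 0 < 2 * n%:R + 1 :> R by rewrite ltr_wpDl// mulr_ge0.
have e'0 : 0 < e' by rewrite divr_gt0.
have [||v [[k Nk <-] bv]] := cl (g @` [set k | (N <= k)%N]) (ball p e').
- by exists N => // k /= Nk; exists k.
- exact: nbhsx_ballx.
exists k => //.
have bv' i : `|g k ord0 i - p ord0 i| <= e'.
  have [_ /(_ ord0 i)] : mx_ball _ _ _ _ p e' (g k) := bv.
  by rewrite /ball /= distrC => /ltW.
apply: le_trans (ler_vn_bd (M := 2 * e') _) _ => [i|].
  rewrite !mxE; apply: le_trans (normc_le_ReIm _) _.
  have := bv' (lshift n i); have := bv' (rshift n i).
  rewrite /g row_mxEl row_mxEr !mxE.
  by case: (x k i ord0) => x1 x2 /=; lra.
rewrite mulrCA mulrA /e' mulrA ler_pdivrMr// mulrC ler_wpM2l ?(ltW e0)//.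
by rewrite lerDl.
Qed.

End Compactness.

(** * Uniqueness: recovering z from y, and zero initial data *)

Section SturmLiouvilleUniqueness.
Variables (R : realType) (d : nat) (a b : R) (P Q W : R -> 'M[R]_d).
Hypothesis ab : a < b.
Hypothesis Om : in_Omega a b P Q W.
Local Notation normc := (@Normc.normc R).
Local Notation mu := (@lebesgue_measure R).
Local Notation C := R[i].
Local Notation SL lam := (Fl (SL0 P Q) (SL1 W) lam).
Local Notation stk y z := (fun t => col_mx (y t) (z t)).
Implicit Types (y z : R -> 'cV[C]_d) (lam : R).

(** If some r_k is nonzero, [coercive_inv_ge] keeps the integrand above a positive constant almost
    everywhere. Measurability is supplied in [inv_integral_eq0] from the integrability of P^{-1}
    v. *)
Lemma inv_form_integral_eq0 (r : 'cV[R]_d) :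
  measurable_fun `[a, b]%classic (fun s => (r^T *m invmx (P s) *m r) ord0 ord0) ->
  \int[mu]_(s in `[a, b]%classic) (r^T *m invmx (P s) *m r) ord0 ord0 = 0 ->
  r = 0.
Proof.
pose g s := (r^T *m invmx (P s) *m r) ord0 ord0.
rewrite -/g => mg ig.
apply/matrixP => k j; rewrite ord1 mxE {j}; apply/eqP; apply/negPn/negP => rk.
have [/Linf_bd[MP MP0 hP] _ _ _ [mu1 [mu2 [mu10 _ hge _]]]] := Om.
have d0 : (0 < d)%N by apply: leq_trans (ltn_ord k).
pose kap := mu1 * ((`|r k ord0| / MP) ^+ 2 / d%:R).
have kap0 : 0 < kap.
  by rewrite mulr_gt0// divr_gt0 ?ltr0n// exprn_gt0// divr_gt0// normr_gt0.
pose M := \sum_j (\sum_i `|r i ord0| * mu1^-1) * `|r j ord0|.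
have m0 : 0 <= mu1^-1 by rewrite invr_ge0 ltW.
have M0 : 0 <= M.
  apply: sumr_ge0 => j _; rewrite mulr_ge0//.
  by apply: sumr_ge0 => i _; rewrite mulr_ge0.
(* kap <= g <= M a.e., so an absolute bound on g - (M + kap) yields the lower
   bound kap (b - a) for the integral of g. *)
have bg : {ae mu, forall s, `[a, b]%classic s -> `|g s - (M + kap)| <= M}.
  apply: ae_imp2 hP hge => s h1 h2 sab.
  have lo : kap <= g s by exact: (coercive_inv_ge mu10 (h2 sab) r k MP0 d0 (h1 sab)).
  have up : g s <= M.
    apply: le_trans (ler_norm _) _; rewrite /g mxE.
    apply: le_trans (ler_norm_sum _ _ _) _; apply: ler_sum => j _.
    rewrite normrM ler_wpM2r// mxE.
    apply: le_trans (ler_norm_sum _ _ _) _; apply: ler_sum => i _.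
    by rewrite normrM mxE ler_wpM2l// (coercive_inv_bd mu10 (h2 sab)).
  by rewrite ler_norml; apply/andP; split; lra.
have mg' : measurable_fun `[a, b]%classic (fun s => g s - (M + kap)).
  by apply: measurable_funB => //; exact: measurable_cst.
have [ig' hI] := le_Rintegral_aebd (ltW ab) mg' bg.
have aec : {ae mu, forall s, `[a, b]%classic s -> `|M + kap| <= `|M + kap|}.
  exact: aeW.
have [ic _] := le_Rintegral_aebd (ltW ab) (@measurable_cst _ _ _ _ _ (M + kap)) aec.
have ig0 : mu.-integrable `[a, b]%classic (EFin \o g).
  apply: eq_integrable (integrable_segD ig' ic) => // s _ /=.
  by rewrite subrK.
move: hI; rewrite RintegralB// [X in `|X - _|]ig sub0r normrN.
have -> : \int[mu]_(x in `[a, b]%classic) (M + kap) = (M + kap) * (b - a).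
  by rewrite Rintegral_cst// [X in fine X](lebesgue_segment (ltW ab)).
rewrite !ger0_norm// ?mulr_ge0 ?subr_ge0 ?(ltW ab) ?addr_ge0 ?(ltW kap0)//.
by rewrite ler_pM2r ?subr_gt0// gerDl leNgt kap0.
Qed.

(** P^{-1} is real, so pairing P^{-1} v with Re v and taking real parts gives the form at Re v;
    pairing with Im v and taking imaginary parts gives it at Im v. *)
Lemma inv_integral_eq0 (v : 'cV[C]_d) :
  (forall i, cintg a b (fun s => (cmx (invmx (P s)) *m v) i ord0)) ->
  (forall i, cint a b (fun s => (cmx (invmx (P s)) *m v) i ord0) = 0) -> v = 0.
Proof.
move=> iv v0.
pose f (r : 'cV[R]_d) s := \sum_i (r i ord0)%:C * (cmx (invmx (P s)) *m v) i ord0.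
have fi r : cintg a b (f r) by apply: cintg_sum => i; exact: cintgZ.
have f0 r : cint a b (f r) = 0.
  rewrite cint_sum; last by move=> i; exact: cintgZ.
  by rewrite big1// => i _; rewrite cintZ// v0 mulr0.
pose re := \col_i complex.Re (v i ord0); pose im := \col_i complex.Im (v i ord0).
have Resum (I : finType) (F : I -> C) : complex.Re (\sum_i F i) = \sum_i complex.Re (F i).
  by elim/big_rec2: _ => // i x y _ <-; rewrite Re_add.
have Imsum (I : finType) (F : I -> C) : complex.Im (\sum_i F i) = \sum_i complex.Im (F i).
  by elim/big_rec2: _ => // i x y _ <-; rewrite Im_add.
have eRe s : (re^T *m invmx (P s) *m re) ord0 ord0 = complex.Re (f re s).
  rewrite -mulmxA mxE /f Resum; apply: eq_bigr => i _; rewrite Re_mul /= mul0r subr0.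
  rewrite !mxE Resum; congr (_ * _); apply: eq_bigr => j _.
  by rewrite !mxE Re_mul /= mul0r subr0.
have eIm s : (im^T *m invmx (P s) *m im) ord0 ord0 = complex.Im (f im s).
  rewrite -mulmxA mxE /f Imsum; apply: eq_bigr => i _; rewrite Im_mul /= mul0r addr0.
  rewrite !mxE Imsum; congr (_ * _); apply: eq_bigr => j _.
  by rewrite !mxE Im_mul /= mul0r addr0.
have re0 : re = 0.
  apply: inv_form_integral_eq0.
    rewrite (_ : (fun s => _) = fun s => complex.Re (f re s)).
      exact: (cintg_meas (fi re)).1.
    exact/funext.
  under eq_Rintegral do rewrite eRe.
  by have := f0 re; rewrite /cint => -[].
have im0 : im = 0.
  apply: inv_form_integral_eq0.
    rewrite (_ : (fun s => _) = fun s => complex.Im (f im s)).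
      exact: (cintg_meas (fi im)).2.
    exact/funext.
  under eq_Rintegral do rewrite eIm.
  by have := f0 im; rewrite /cint => -[].
apply/matrixP => i j; rewrite ord1 mxE; apply: complexP.
  by have /matrixP/(_ i ord0) := re0; rewrite !mxE.
by have /matrixP/(_ i ord0) := im0; rewrite !mxE.
Qed.

(** If y = 0 then z' = 0, so z is constant, and y(b) - y(a) = 0 says that the integral of P^{-1}
    z(a) vanishes. *)
Lemma lsol_y0_z0 lam y z : lsol a b (SL lam) (stk y z) ->
  (forall t, a <= t <= b -> y t = 0) -> forall t, a <= t <= b -> z t = 0.
Proof.
move=> /(lsol_components Om)[M M0 h] y0.
have aab : a <= a <= b by rewrite lexx ltW.
have zc t : a <= t <= b -> z t = z a.
  move=> /[dup] tab /andP[at_ tb]; apply/matrixP => i j; rewrite ord1.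
  have [_ _ [_ e] _] := h i; rewrite e//.
  rewrite (@eq_cint _ _ _ _ (fun=> 0)) ?cint0 ?addr0// => s /andP[as_ st].
  by rewrite y0 ?mulmx0 ?mxE// as_ (le_trans st tb).
have za : z a = 0.
  have ez i s : a <= s <= b -> (cmx (invmx (P s)) *m z s) i ord0 =
    (cmx (invmx (P s)) *m z a) i ord0 by move=> sab; rewrite (zc s sab).
  apply: inv_integral_eq0 => i.
    by have [[iy _] _ _ _] := h i; apply: eq_cintg iy; exact: ez.
  have [[_ e] _ _ _] := h i; have := e b; rewrite lexx (ltW ab) => /(_ isT).
  rewrite !y0 ?lexx ?(ltW ab)// !mxE add0r => /esym e0; rewrite -[RHS]e0.
  by apply: eq_cint => s sab; rewrite ez.
by move=> t tab; rewrite zc.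
Qed.

Lemma lsol_init0 lam y z : lsol a b (SL lam) (stk y z) ->
  y a = 0 -> z a = 0 -> forall t, a <= t <= b -> y t = 0.
Proof.
move=> h ya za t tab; have [C0 C00 [b0 b1]] := SL_aebd Om.
have [K K0 hK] := lsol_stable (ltW ab) C00 b0 b1 (normr_ge0 lam).
have l0 : lsol a b (SL lam) (fun=> 0).
  have := lsolZ 0 h; congr (lsol a b _ _).
  by apply/funext => s; rewrite scale0r.
have := hK lam lam _ _ (lexx _) (lexx _) h l0 t tab.
rewrite ya za col_mx0 !subr0 vn0 add0r mulr0 mulr0 => /vn_le0.
by rewrite -col_mx0 => /eq_col_mx[].
Qed.

(** The normalization fixes only a real part; the imaginary part vanishes because W is real
    symmetric almost everywhere. *)
Lemma Wform_normalized lam y z : lsol a b (SL lam) (stk y z) ->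
  \int[mu]_(t in `[a, b]%classic)
     complex.Re ((adjmx (y t) *m cmx (W t) *m y t) ord0 ord0) = 1 ->
  cint a b (fun s => (adjmx (y s) *m cmx (W s) *m y s) ord0 ord0) = 1.
Proof.
move=> h e; apply: complexP => //=.
have [_ mI] := Wform_meas ab Om h h.
have bI : {ae mu, forall s, `[a, b]%classic s ->
    `|complex.Im ((adjmx (y s) *m cmx (W s) *m y s) ord0 ord0)| <= 0}.
  have [_ _ _ [_ _ sW] _] := Om.
  apply: ae_imp sW => s hs sab.
  have : adjmx (adjmx (y s) *m cmx (W s) *m y s) = adjmx (y s) *m cmx (W s) *m y s.
    by rewrite !adjmxM adjmxK adjmx_cmx hs// mulmxA.
  move=> /matrixP/(_ ord0 ord0); rewrite 2![LHS]mxE.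
  by case: (_ ord0 ord0) => u v [] /= hv; rewrite normr_le0; apply/eqP; lra.
have [_] := le_Rintegral_aebd (ltW ab) mI bI.
by rewrite normr0 mul0r normr_le0 => /eqP.
Qed.

End SturmLiouvilleUniqueness.

(** * Eigenfunctions along a sequence of converging boundary conditions *)

Section EigenApproximation.
Variables (R : realType) (d : nat) (a b : R) (P Q W : R -> 'M[R]_d).
Hypothesis ab : a < b.
Hypothesis Om : in_Omega a b P Q W.
Local Notation normc := (@Normc.normc R).
Local Notation C := R[i].
Local Notation SL lam := (Fl (SL0 P Q) (SL1 W) lam).
Local Notation stk y z := (fun t => col_mx (y t) (z t)).
Variables (K : {set 'I_(d + d)}) (S0 : 'M[C]_(d + d)) (lam_s : R).

Lemma ler_vn_bdry (y z y' z' : R -> 'cV[C]_d) :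
  vn (rhov a b y - rhov a b y') + vn (etav a b z - etav a b z') <=
  vn (col_mx (y a) (z a) - col_mx (y' a) (z' a)) +
  vn (col_mx (y b) (z b) - col_mx (y' b) (z' b)).
Proof.
rewrite /rhov /etav !opp_col_mx !add_col_mx !vn_col_mx.
have -> : - y a - - y' a = - (y a - y' a) by rewrite opprB opprK addrC.
rewrite vnN le_eqVlt; apply/orP; left; apply/eqP; ring.
Qed.

Lemma bc_limit (Sk : nat -> 'M[C]_(d + d)) (yk zk : nat -> R -> 'cV[C]_d)
    (y z : R -> 'cV[C]_d) (c : R) :
  (forall k i j, normc (Sk k i j - S0 i j) <= k.+1%:R^-1) ->
  (forall k, vn (col_mx (yk k a) (zk k a) - col_mx (y a) (z a)) <= c / k.+1%:R) ->
  (forall k, vn (col_mx (yk k b) (zk k b) - col_mx (y b) (z b)) <= c / k.+1%:R) ->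
  (forall k, bc_of K (Sk k) *m bvals a b (yk k) (zk k) = 0) ->
  bc_of K S0 *m bvals a b y z = 0.
Proof.
move=> Sc ca cb bk.
pose u := ucomb K (rhov a b y) (etav a b z).
pose v := vcomb K (rhov a b y) (etav a b z).
pose uk k := ucomb K (rhov a b (yk k)) (etav a b (zk k)).
pose vk k := vcomb K (rhov a b (yk k)) (etav a b (zk k)).
have c0 : 0 <= c by have := ca 0%N; rewrite divr1; apply: le_trans; exact: vn_ge0.
have k0 k : 0 <= (k.+1%:R^-1 : R) by rewrite invr_ge0.
have k1 k : (k.+1%:R^-1 : R) <= 1 by rewrite invf_le1 ?ltr0n// ler1n.
have bd k : vn (rhov a b (yk k) - rhov a b y) + vn (etav a b (zk k) - etav a b z)
    <= 2 * c / k.+1%:R.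
  apply: le_trans (ler_vn_bdry _ _ _ _) _.
  by rewrite -mulrA mulr_natl mulr2n lerD.
have ud k : vn (uk k - u) <= 2 * c / k.+1%:R.
  by rewrite ucombB; apply: le_trans (ler_vn_ucomb _ _ _) _.
have vd k : vn (vk k - v) <= 2 * c / k.+1%:R.
  by rewrite vcombB; apply: le_trans (ler_vn_vcomb _ _ _) _.
have eE : bc_of K S0 *m bvals a b y z = S0 *m u + v by rewrite /bvals bc_of_mul.
have eEk k : Sk k *m uk k + vk k = 0 by rewrite -bc_of_mul -(bk k).
rewrite eE; apply: vn_le0.
pose M := \sum_i \sum_j normc (S0 i j).
have hM i j : normc (S0 i j) <= M.
  rewrite /M (bigD1 i)//= (bigD1 j)//= -addrA lerDl addr_ge0//.
    by apply: sumr_ge0 => l _; exact: normc_ge0.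
  by apply: sumr_ge0 => l _; apply: sumr_ge0 => m _; exact: normc_ge0.
have M0 : 0 <= M.
  by apply: sumr_ge0 => l _; apply: sumr_ge0 => m _; exact: normc_ge0.
pose n : R := (d + d)%:R.
have n0 : 0 <= n by rewrite ler0n.
apply: (@le0_of_le_inv _ _ (n * M * (2 * c) + n * (vn u + 2 * c) + 2 * c)) => k.
(* Subtracting the relation Sk uk + vk = 0 leaves three differences, each O(1 / (k + 1)). *)
have -> : S0 *m u + v = - (S0 *m (uk k - u)) + (- ((Sk k - S0) *m uk k) - (vk k - v)).
  rewrite -[LHS]addr0 -oppr0 -(eEk k) mulmxBr mulmxBl.
  move: (S0 *m u) (S0 *m uk k) (Sk k *m uk k) (vk k) => x1 x2 x3 x4.
  by apply/matrixP => i j; rewrite !mxE; ring.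
have -> : (n * M * (2 * c) + n * (vn u + 2 * c) + 2 * c) / k.+1%:R =
  n * M * (2 * c / k.+1%:R) + (n * k.+1%:R^-1 * (vn u + 2 * c) + 2 * c / k.+1%:R).
  by ring.
apply: le_trans (ler_vnD _ _) _; rewrite vnN; apply: lerD.
  apply: le_trans (ler_vn_mulmx _ hM) _.
  by rewrite ler_wpM2l// mulr_ge0.
apply: le_trans (ler_vnD _ _) _; rewrite !vnN; apply: lerD => //.
have hS i j : normc ((Sk k - S0) i j) <= k.+1%:R^-1 by rewrite !mxE.
apply: le_trans (ler_vn_mulmx _ hS) _; rewrite ler_wpM2l ?mulr_ge0//.
rewrite -(subrK u (uk k)) addrC (le_trans (ler_vnD _ _))// lerD2l.
by rewrite (le_trans (ud k))// ler_piMr// mulr_ge0.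
Qed.

Variables (y z : R -> 'cV[C]_d).
Hypothesis simple : is_simple_eigenvalue a b P Q W (bc_of K S0) lam_s.
Hypothesis sol : is_solution a b P Q W (bc_of K S0) lam_s y z.
Hypothesis ynt : nontrivial a b y.

(** Simplicity compares with some unnamed eigenfunction [y0]. Nontriviality of y makes its factor
    [c1] invertible, and [lsol_y0_z0] applied to y' - c y extends the proportionality to z. *)
Lemma simple_unique y' z' :
  is_solution a b P Q W (bc_of K S0) lam_s y' z' ->
  exists c : C, forall t, a <= t <= b -> y' t = c *: y t /\ z' t = c *: z t.
Proof.
move=> sol'; have [y0 [z0 [_ _ uniq]]] := simple.
have [c1 hc1] := uniq _ _ sol; have [c2 hc2] := uniq _ _ sol'.
have itv t : a <= t <= b -> Iab a b t by rewrite /Iab /= in_itv.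
have c10 : c1 != 0.
  by have [t [tab]] := ynt; rewrite hc1//; apply: contraNneq => ->; rewrite scale0r.
pose c := c2 / c1.
have yc t : a <= t <= b -> y' t = c *: y t.
  by move=> /itv tab; rewrite hc1// hc2// scalerA /c mulfVK.
exists c => t tab; split; first exact: yc.
have [l _] := (is_solutionE _ _ _ _ _ _ _ _ _).1 sol.
have [l' _] := (is_solutionE _ _ _ _ _ _ _ _ _).1 sol'.
have ld := lsolB l' (lsolZ c l).
have ld' : lsol a b (SL lam_s) (stk (fun t => y' t - c *: y t) (fun t => z' t - c *: z t)).
  move: ld; congr (lsol a b _ _); apply/funext => s.
  by rewrite scale_col_mx opp_col_mx add_col_mx.
apply/eqP; rewrite -subr_eq0; apply/eqP.
apply: (lsol_y0_z0 ab Om ld') => // s sab.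
by rewrite yc// subrr.
Qed.

Lemma eigen_approx (Sk : nat -> 'M[C]_(d + d)) (lamk : nat -> R)
    (yk zk : nat -> R -> 'cV[C]_d) (e : R) : 0 < e ->
  (forall k i j, normc (Sk k i j - S0 i j) <= k.+1%:R^-1) ->
  (forall k, `|lamk k - lam_s| <= k.+1%:R^-1) ->
  (forall k, is_solution a b P Q W (bc_of K (Sk k)) (lamk k) (yk k) (zk k)) ->
  (forall k, nontrivial a b (yk k)) ->
  exists k (c : C), forall t, a <= t <= b ->
    vn (c *: yk k t - y t) + vn (c *: zk k t - z t) <= e.
Proof.
move=> e0 Sc lc solk ntk.
have lk k : lsol a b (SL (lamk k)) (stk (yk k) (zk k)).
  by have [] := (is_solutionE _ _ _ _ _ _ _ _ _).1 (solk k).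
have bk k : bc_of K (Sk k) *m bvals a b (yk k) (zk k) = 0.
  by have [] := (is_solutionE _ _ _ _ _ _ _ _ _).1 (solk k).
(* The full initial value of an eigenfunction is nonzero by [lsol_init0]; dividing by its norm keeps
   the sequence bounded. *)
pose N k := vn (col_mx (yk k a) (zk k a)).
have N0 k : 0 < N k.
  rewrite lt_neqAle vn_ge0 andbT eq_sym; apply/negP => /eqP N0.
  have : col_mx (yk k a) (zk k a) = 0 by apply: vn_le0; rewrite -/(N k) N0.
  rewrite -col_mx0 => /eq_col_mx[ya za].
  have [t [tab]] := ntk k; move/eqP; apply.
  by apply: (lsol_init0 ab Om (lk k) ya za); move: tab; rewrite /Iab /= in_itv.
pose nk k : C := ((N k)^-1)%:C.
pose vk k t := nk k *: col_mx (yk k t) (zk k t).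
have v1 k : vn (vk k a) = 1.
  rewrite vnZ /nk normc_real ger0_norm ?invr_ge0 ?(ltW (N0 k))//.
  by rewrite mulVf// gt_eqF.
have vB k : vn (vk k a) <= 1 by rewrite v1.
have [x hx] := vec_cluster vB.
have j0 j : 0 < (j.+1%:R^-1 : R) by rewrite invr_gt0.
(* [f] may fail to increase; [j <= f j] already transfers the rates of [Sk] and [lamk]. *)
have /choice[f hf] : forall j : nat, exists k, (j <= k)%N /\ vn (vk k a - x) <= j.+1%:R^-1.
  by move=> j; have [k jk h] := hx j.+1%:R^-1 j (j0 j); exists k.
have fle j : ((f j).+1%:R^-1 : R) <= j.+1%:R^-1.
  by rewrite lef_pV2 ?posrE// ler_nat ltnS; case: (hf j).
(* Nonvanishing of the cluster point is what makes the factor [c'] below invertible. *)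
have x1 : 1 <= vn x.
  rewrite -subr_le0; apply: (@le0_of_le_inv _ _ 1) => j; rewrite mul1r.
  have [_ h] := hf j; apply: le_trans h; rewrite lerBlDr -(v1 (f j)).
  by rewrite -{1}(subrK x (vk (f j) a)) ler_vnD.
have [C0 C00 [b0 b1]] := SL_aebd Om.
have [] := @lsol_limit R _ a b (ltW ab) _ _ C0 C00 b0 b1 (`|lam_s| + 1) lam_s
  (fun j => lamk (f j)) (fun j => vk (f j)) x.
- by rewrite lerDl.
- move=> j; rewrite -(subrK lam_s (lamk (f j))) addrC.
  rewrite (le_trans (ler_normD _ _))// lerD2l (le_trans (lc _))//.
  by rewrite invf_le1 ?ltr0n// ler1n.
- by move=> j; rewrite (le_trans (lc _)).
- by move=> j; have [] := hf j.
- by move=> j; apply: lsolZ.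
move=> w [c [lw wa hw]].
pose yw t := usubmx (w t); pose zw t := dsubmx (w t).
have wE t : w t = col_mx (yw t) (zw t) by rewrite vsubmxK.
have vE k t : vk k t = col_mx (nk k *: yk k t) (nk k *: zk k t).
  by rewrite /vk scale_col_mx.
have solw : is_solution a b P Q W (bc_of K S0) lam_s yw zw.
  apply/is_solutionE; split.
    by move: lw; congr (lsol a b _ _); apply/funext => t; exact: wE.
  apply: (@bc_limit (fun j => Sk (f j)) (fun j t => nk (f j) *: yk (f j) t)
    (fun j t => nk (f j) *: zk (f j) t) _ _ c).
  - by move=> j i l; apply: le_trans (Sc _ _ _) _.
  - by move=> j; rewrite -vE -wE; apply: hw; rewrite lexx ltW.
  - by move=> j; rewrite -vE -wE; apply: hw; rewrite lexx ltW.
  - move=> j; have := bk (f j); rewrite /bvals => h.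
    by rewrite -scalerN -!scale_col_mx -scalemxAr h scaler0.
have [c' hc'] := simple_unique solw.
have ws t : a <= t <= b -> w t = c' *: col_mx (y t) (z t).
  by move=> /hc'[h1 h2]; rewrite wE h1 h2 scale_col_mx.
have c'0 : c' != 0.
  apply/negP => /eqP c'0; have := ws a; rewrite lexx (ltW ab) wa => /(_ isT).
  rewrite c'0 scale0r => x0; move: x1; rewrite x0 vn0.
  by rewrite leNgt ltr01.
have [j hj] := inv_nat_small (normc c'^-1 * c) e0.
(* [nk] is the normalization and [c'^-1] turns the limit w = c' (y, z) back into (y, z). *)
exists (f j), (c'^-1 * nk (f j)) => t tab.
rewrite -vn_col_mx -add_col_mx -opp_col_mx -!scalerA -!scale_col_mx.
have -> : col_mx (y t) (z t) = c'^-1 *: w t.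
  by rewrite ws// scalerA mulVf// scale1r.
rewrite -scalerBr vnZ; apply: le_trans (ltW (hj j (leqnn j))).
rewrite -mulrA ler_wpM2l ?normc_ge0//.
exact: hw.
Qed.

End EigenApproximation.

(** * Increment formula and the derivative of the branch *)

Section EigenvalueDerivative.
Variables (R : realType) (d : nat) (a b : R) (P Q W : R -> 'M[R]_d).
Hypothesis ab : a < b.
Hypothesis Om : in_Omega a b P Q W.
Local Notation normc := (@Normc.normc R).
Local Notation mu := (@lebesgue_measure R).
Local Notation C := R[i].
Local Notation SL lam := (Fl (SL0 P Q) (SL1 W) lam).
Local Notation stk y z := (fun t => col_mx (y t) (z t)).
Variables (K : {set 'I_(d + d)}).
Implicit Types (y z : R -> 'cV[C]_d) (S H : 'M[C]_(d + d)) (lam : R).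

Lemma uvecE y z : uvec K a b y z = ucomb K (rhov a b y) (etav a b z).
Proof. by []. Qed.

(** The boundary conditions read v = - S u and v' = - (S + H) u', so u^* v' - v^* u' collapses to -
    u^* H u' because S is Hermitian. *)
Lemma eigenvalue_increment S H lam lam' y z y' z' : is_herm S ->
  is_solution a b P Q W (bc_of K S) lam y z ->
  is_solution a b P Q W (bc_of K (S + H)) lam' y' z' ->
  (lam' - lam)%:C *
    cint a b (fun s => (adjmx (y s) *m cmx (W s) *m y' s) ord0 ord0) =
  (adjmx (uvec K a b y z) *m H *m uvec K a b y' z') ord0 ord0.
Proof.
move=> hS /is_solutionE[l bc] /is_solutionE[l' bc'].
pose u := ucomb K (rhov a b y) (etav a b z).
pose v := vcomb K (rhov a b y) (etav a b z).
pose u' := ucomb K (rhov a b y') (etav a b z').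
pose v' := vcomb K (rhov a b y') (etav a b z').
have vE : v = - (S *m u).
  by apply/eqP; rewrite -addr_eq0 addrC -bc_of_mul -bc.
have vE' : v' = - ((S + H) *m u').
  by apply/eqP; rewrite -addr_eq0 addrC -bc_of_mul -bc'.
have := lagrange_identity ab Om l l'; rewrite -(symplectic_comb K) -/u -/v -/u' -/v' vE vE'.
rewrite adjmxN adjmxM hS mulmxN mulNmx mulmxDl mulmxDr !mulmxA.
rewrite mulNr => /(congr1 -%R); rewrite opprK => <-.
rewrite !uvecE -/u -/u'; move: (adjmx u *m S *m u') => X1.
move: (adjmx u *m H *m u') => X2; rewrite !mxE; ring.
Qed.

(** Shows that the coefficient of lam' - lam in [eigenvalue_increment] is close to 1. The constant
    depends on y only, so it can be fixed before the perturbation. *)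
Lemma Wform_close lam y z : lsol a b (SL lam) (stk y z) ->
  cint a b (fun s => (adjmx (y s) *m cmx (W s) *m y s) ord0 ord0) = 1 ->
  exists2 c : R, 0 <= c & forall lam' y' z' (e : R), 0 <= e ->
    lsol a b (SL lam') (stk y' z') ->
    (forall t, a <= t <= b -> vn (y' t - y t) <= e) ->
    normc (cint a b (fun s => (adjmx (y s) *m cmx (W s) *m y' s) ord0 ord0) - 1)
      <= c * e.
Proof.
move=> l I1; have [B B0 hB] := lsol_bounded l.
have [_ _ /Linf_bd[MW MW0 hW] _ _] := Om.
exists (2 * (d%:R * MW * B) * (b - a)).
  by rewrite !mulr_ge0// ?subr_ge0// ltW.
move=> lam' y' z' e e0 l' he.
have yB s : a <= s <= b -> vn (y s) <= B.
  by move=> /hB; apply: le_trans; rewrite vn_col_mx lerDl vn_ge0.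
have y'B s : a <= s <= b -> vn (y' s) <= B + e.
  move=> sab; rewrite -(subrK (y s) (y' s)) addrC (le_trans (ler_vnD _ _))//.
  by rewrite lerD ?yB// he.
have formI v v' (M : R) : cmeas a b (fun s => (adjmx (v s) *m cmx (W s) *m v' s) ord0 ord0) ->
    (forall s, a <= s <= b -> vn (v s) * vn (v' s) <= M) ->
    cintg a b (fun s => (adjmx (v s) *m cmx (W s) *m v' s) ord0 ord0).
  move=> mv hM; have [c c0 hc] := Wform_aebd Om v v'.
  apply: (@cmeas_ae_bd_cintg _ _ _ (c * M)) => //; first exact: ltW.
  by apply: ae_imp hc => s hs sab; rewrite (le_trans (hs sab))// ler_wpM2l// hM.
have i1 := formI y y (B * B) (Wform_meas ab Om l l).
have {}i1 := i1 (fun s sab => ler_pM (vn_ge0 _) (vn_ge0 _) (yB s sab) (yB s sab)).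
have i2 := formI y y' (B * (B + e)) (Wform_meas ab Om l l').
have {}i2 := i2 (fun s sab => ler_pM (vn_ge0 _) (vn_ge0 _) (yB s sab) (y'B s sab)).
rewrite -I1 -cintB//.
have -> : 2 * (d%:R * MW * B) * (b - a) * e = 2 * (d%:R * MW * B * e) * (b - a) by ring.
apply: cint_bound; [exact: ltW|by rewrite !mulr_ge0// ltW|exact: cintgB|].
apply: ae_imp hW => s hs sab /=.
have -> : (adjmx (y s) *m cmx (W s) *m y' s) ord0 ord0 -
    (adjmx (y s) *m cmx (W s) *m y s) ord0 ord0 =
    (adjmx (y s) *m (cmx (W s) *m (y' s - y s))) ord0 ord0.
  rewrite mulmxA mulmxBr.
  by move: (_ *m y' s) (_ *m y s) => X1 X2; rewrite !mxE.
apply: (@le_trans _ _ (vn (y s) * vn (cmx (W s) *m (y' s - y s)))).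
  by apply: ler_normc_dot => j; rewrite !mxE normc_conj ler_normc_vn.
have -> : d%:R * MW * B * e = B * (d%:R * MW * e) by ring.
apply: ler_pM; rewrite ?vn_ge0 ?yB//.
apply: le_trans (ler_vn_mulmx _ (c := MW) _) _.
  by move=> i j; rewrite mxE normc_real hs.
by rewrite ler_wpM2l ?he// mulr_ge0// ltW.
Qed.

(** The scaling factor is absorbed in y' and z'; closeness to y takes the place of a
    normalization. *)
Lemma branch_eigenfunction_close S0 lam_s y z U L :
  is_herm S0 ->
  is_simple_eigenvalue a b P Q W (bc_of K S0) lam_s ->
  is_solution a b P Q W (bc_of K S0) lam_s y z ->
  nontrivial a b y ->
  simple_eigen_branch a b P Q W K S0 lam_s U L ->
  forall e : R, 0 < e -> exists2 del : R, 0 < del &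
    forall H, is_herm H -> (forall i j, normc (H i j) < del) ->
    exists y' z', is_solution a b P Q W (bc_of K (S0 + H)) (L (S0 + H)) y' z' /\
      forall t, a <= t <= b -> vn (y' t - y t) + vn (z' t - z t) <= e.
Proof.
move=> hS0 simple sol ynt [[_ [del0 [del00 hU]]] cL LS0 [r1 [r2 [_ _ br]]]] e e0.
have hD H : is_herm H -> is_herm (S0 + H) by rewrite /is_herm adjmxD hS0 => ->.
have closeE H (r : R) : (forall i j, normc (H i j) < r) -> mx_close (S0 + H) S0 r.
  by move=> h i j; rewrite mxE addrAC subrr add0r.
have US0 : U S0.
  by apply: hU => // i j; rewrite subrr Normc.normc0.
apply: contrapT => nex.
have /choice[Hk hHk] : forall k : nat, exists H, [/\ forall i j, normc (H i j) < k.+1%:R^-1,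
    U (S0 + H), `|L (S0 + H) - lam_s| <= k.+1%:R^-1 &
    ~ exists y' z', is_solution a b P Q W (bc_of K (S0 + H)) (L (S0 + H)) y' z' /\
      forall t, a <= t <= b -> vn (y' t - y t) + vn (z' t - z t) <= e].
  move=> k; have k0 : 0 < (k.+1%:R^-1 : R) by rewrite invr_gt0.
  have [del1 [del10 hc]] := cL _ US0 _ k0.
  apply: contrapT => nH; apply: nex.
  (* [del0] keeps S0 + H in [U], [del1] brings its eigenvalue within 1 / (k + 1) of [lam_s], and the
     last radius bounds [H]. *)
  exists (Num.min del0 (Num.min del1 k.+1%:R^-1)).
    by rewrite !lt_min del00 del10 k0.
  move=> H hH small; apply: contrapT => nyz; apply: nH; exists H.
  have s0 i j : normc (H i j) < del0.
    by have := small i j; rewrite !lt_min => /and3P[].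
  have s1 i j : normc (H i j) < del1.
    by have := small i j; rewrite !lt_min => /and3P[].
  have UH : U (S0 + H) by apply: hU; [exact: hD|exact: closeE].
  split => //.
  - by move=> i j; have := small i j; rewrite !lt_min => /and3P[].
  - by rewrite -LS0 ltW// hc//; exact: closeE.
have /choice[yz hyz] : forall k, exists yz : (R -> 'cV[C]_d) * (R -> 'cV[C]_d),
    is_solution a b P Q W (bc_of K (S0 + Hk k)) (L (S0 + Hk k)) yz.1 yz.2 /\
    nontrivial a b yz.1.
  move=> k; have [_ Uk _ _] := hHk k; have [_ [y0 [z0 [s0 n0 _]]] _] := br _ Uk.
  by exists (y0, z0).
have [||||k [c hc]] := eigen_approx ab Om simple sol ynt (Sk := fun k => S0 + Hk k)
  (lamk := fun k => L (S0 + Hk k)) (yk := fun k => (yz k).1) (zk := fun k => (yz k).2) e0.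
- by move=> k i j; have [h _ _ _] := hHk k; rewrite mxE addrAC subrr add0r ltW.
- by move=> k; have [] := hHk k.
- by move=> k; have [] := hyz k.
- by move=> k; have [] := hyz k.
have [_ _ _] := hHk k; apply.
exists (fun t => c *: (yz k).1 t), (fun t => c *: (yz k).2 t); split => //.
have [/is_solutionE[l bc] _] := hyz k.
apply/is_solutionE; split.
  have := lsolZ c l; congr (lsol a b _ _); apply/funext => t.
  by rewrite scale_col_mx.
move: bc; rewrite /bvals => bc.
by rewrite -scalerN -!scale_col_mx -scalemxAr bc scaler0.
Qed.

End EigenvalueDerivative.

(** Choosing [r] as the largest entry modulus of [H] gives the Frechet remainder estimate in the
    maximum norm. *)
Theorem theorem8p1 (R : realType) (d : nat) (a b : R)
  (P Q W : R -> 'M[R]_d) (K : {set 'I_(d + d)})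
  (S0 : 'M[R[i]]_(d + d)) (lam_s : R) (y z : R -> 'cV[R[i]]_d)
  (U : set 'M[R[i]]_(d + d)) (L : 'M[R[i]]_(d + d) -> R) :
  (2 <= d)%N ->
  a < b ->
  in_Omega a b P Q W ->
  is_herm S0 ->
  is_simple_eigenvalue a b P Q W (bc_of K S0) lam_s ->
  is_solution a b P Q W (bc_of K S0) lam_s y z ->
  nontrivial a b y ->
  \int[@lebesgue_measure R]_(t in `[a, b]%classic)
     complex.Re ((adjmx (y t) *m cmx (W t) *m y t) ord0 ord0) = 1 ->
  simple_eigen_branch a b P Q W K S0 lam_s U L ->
  let u := uvec K a b y z in
  forall eps : R, 0 < eps -> exists del : R, 0 < del /\
    forall H : 'M[R[i]]_(d + d), is_herm H ->
    forall r : R, 0 <= r -> r < del ->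
      (forall i j, Normc.normc (H i j) <= r) ->
      Normc.normc ((L (S0 + H) - L S0)%:C - (adjmx u *m H *m u) ord0 ord0)
        <= eps * r.
Proof.
move=> _ ab Om hS0 simple sol ynt nrm branch u eps eps0.
have [l _] := (is_solutionE _ _ _ _ _ _ _ _ _).1 sol.
have [C1 C10 hC1] := Wform_close ab Om l (Wform_normalized ab Om l nrm).
have LS0 : L S0 = lam_s by case: branch.
pose V := vn u; have V0 : 0 <= V by exact: vn_ge0.
(* The first two summands are the coefficients of e r in the final estimate, from D (I - 1) and X' -
   X; the 1 makes [T] positive. *)
pose T := 2 * C1 * (V * (V + 2)) + 2 * V + 1.
have T0 : 0 < T by rewrite ltr_wpDl// addr_ge0// !mulr_ge0// addr_ge0.
(* The three bounds give |u'| <= V + 2, |I - 1| <= 1/2 and the final eps. *)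
pose e := Num.min 1 (Num.min (2 * C1 + 1)^-1 (eps / T)).
have C11 : 0 < 2 * C1 + 1 by rewrite ltr_wpDl// mulr_ge0.
have e0 : 0 < e by rewrite !lt_min ltr01 invr_gt0 C11 divr_gt0.
have e1 : e <= 1 by rewrite /e ge_min lexx.
have eC : C1 * e <= 2^-1.
  have : e <= (2 * C1 + 1)^-1 by rewrite /e !ge_min lexx orbT.
  rewrite -[leRHS]mul1r ler_pdivlMr// => h; lra.
have eT : T * e <= eps.
  have : e <= eps / T by rewrite /e !ge_min lexx !orbT.
  by rewrite ler_pdivlMr// mulrC.
have [del del0 hdel] := branch_eigenfunction_close ab Om hS0 simple sol ynt branch e0.
exists del; split => // H hH r r0 rdel Hr.
have [|y' [z' [sol' close]]] := hdel H hH.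
  by move=> i j; exact: le_lt_trans (Hr i j) rdel.
have [l' _] := (is_solutionE _ _ _ _ _ _ _ _ _).1 sol'.
have yc t : a <= t <= b -> vn (y' t - y t) <= e.
  by move=> /close; apply: le_trans; rewrite lerDl vn_ge0.
have hI := hC1 _ _ _ _ (ltW e0) l' yc.
have key := eigenvalue_increment ab Om hS0 sol sol'.
rewrite LS0; set D := (L (S0 + H) - lam_s)%:C in key *.
set I := cint _ _ _ in hI key; set u' := uvec K a b y' z' in key; rewrite -/u in key.
have du : vn (u' - u) <= 2 * e.
  rewrite /u' /u !uvecE ucombB (le_trans (ler_vn_ucomb _ _ _))//.
  rewrite (le_trans (ler_vn_bdry _ _ _ _ _ _))// mulr_natl mulr2n.
  by rewrite !opp_col_mx !add_col_mx !vn_col_mx lerD// close// lexx ltW.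
have uH j : Normc.normc ((adjmx u *m H) ord0 j) <= V * r.
  rewrite mxE (le_trans (ler_normc_sum _ _))// /V /vn mulr_suml.
  apply: ler_sum => i _; rewrite Normc.normcM ler_pM ?normc_ge0//.
  by rewrite !mxE normc_conj.
set X := (adjmx u *m H *m u) ord0 ord0; set X' := (adjmx u *m H *m u') ord0 ord0 in key.
have Vr0 : 0 <= V * r by rewrite mulr_ge0.
have dX : Normc.normc (X' - X) <= V * r * (2 * e).
  have -> : X' - X = (adjmx u *m H *m (u' - u)) ord0 ord0.
    rewrite /X' /X mulmxBr.
    by move: (_ *m u') (_ *m u) => X1 X2; rewrite !mxE.
  by rewrite (le_trans (ler_normc_dot _ uH))// ler_wpM2l.
have hX' : Normc.normc X' <= V * r * (V + 2).
  rewrite (le_trans (ler_normc_dot _ uH))// ler_wpM2l//.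
  rewrite -(subrK u u') addrC (le_trans (ler_vnD _ _))// lerD2l.
  by rewrite (le_trans du)//; lra.
have D2 : Normc.normc D <= 2 * (V * r * (V + 2)).
  have hI' : Normc.normc (I - 1) <= 2^-1 by exact: le_trans eC.
  (* The increment formula D I = X' is rewritten so that the last term, at most |D| / 2, can be
     absorbed. *)
  have DE : D = X' - D * (I - 1) by rewrite -key; ring.
  have : Normc.normc D <= Normc.normc X' + Normc.normc D * 2^-1.
    rewrite {1}DE (le_trans (le_normcD _ _))// normcN Normc.normcM lerD2l.
    by rewrite ler_wpM2l ?normc_ge0.
  move: hX'; set p := V * r * (V + 2); lra.
have -> : D - X = - (D * (I - 1)) + (X' - X) by rewrite -key; ring.
rewrite (le_trans (le_normcD _ _))// normcN Normc.normcM.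
apply: (@le_trans _ _ (2 * (V * r * (V + 2)) * (C1 * e) + V * r * (2 * e))).
  by apply: lerD => //; apply: ler_pM; rewrite ?normc_ge0.
apply: (@le_trans _ _ (T * e * r)); last by rewrite ler_wpM2r.
have -> : T * e * r = 2 * (V * r * (V + 2)) * (C1 * e) + V * r * (2 * e) + e * r.
  by rewrite /T; ring.
by rewrite lerDl mulr_ge0// ltW.
Qed.
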